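(* Let $m\in\mathbb{N}$, let $(M,g)$ be an $m$-dimensional Riemannian manifold with Riemannian distance $d$, let $\rho\in(0,1]$, $K>0$, $\alpha>1$, $\beta>1$, and define $r,q:[0,\rho)\to[0,\infty)$ by $r(0)=q(0)=0$ and, for $h\in(0,\rho)$, $$r(h)=\bigl(\log_2(h^{-1})\bigr)^{-\beta},\qquad q(h)=K\,\bigl(\log_2(h^{-1})\bigr)^{-\alpha}\,h^m .$$ Suppose that $\phi=(\phi(x),\,x\in M)$ is a real-valued random field on a probability space $(\Omega,\mathcal{A},P)$ such that for all $x,y\in M$ with $d(x,y)<\rho$, $$P\Bigl(\bigl|\phi(x)-\phi(y)\bigr|>r\bigl(d(x,y)\bigr)\Bigr)\le q\bigl(d(x,y)\bigr).$$ Then $\phi$ has a locally uniformly continuous modification.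
   Context: An $m$-dimensional Riemannian manifold $(M,g)$ is a connected $m$-dimensional $C^\infty$-manifold $M$ together with a symmetric, strictly positive definite (smooth) tensor field $g$ of type $(0,2)$. Its Riemannian (topological) metric $d(x,y)$ is the infimum of the lengths $\int_a^b g_{c(t)}(c'(t),c'(t))^{1/2}\,dt$ of curve segments $c:[a,b]\to M$ joining $x$ and $y$. A real-valued random field $\phi$ on $(\Omega,\mathcal{A},P)$ indexed by $M$ is a family of real-valued random variables $\phi(x)$, $x\in M$. A modification of $\phi$ is a random field $\psi=(\psi(x),\,x\in M)$ on the same probability space such that $P(\psi(x)=\phi(x))=1$ for every $x\in M$. It is locally uniformly continuous if for every $\omega\in\Omega$ the map $\psi(\cdot,\omega):M\to\mathbb{R}$ is locally uniformly continuous, i.e. every $z\in M$ has a neighborhood (possibly depending on $\omega$) on which $\psi(\cdot,\omega)$ is uniformly continuous with respect to $d$. *)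

(* Defs.v *)
From HB Require Import structures.
From mathcomp Require Import all_boot all_order all_algebra.
From mathcomp Require Import all_classical all_reals all_analysis.

Set Implicit Arguments.
Unset Strict Implicit.
Unset Printing Implicit Defensive.
Import Order.TTheory GRing.Theory Num.Theory.
Import numFieldNormedType.Exports.

Local Open Scope classical_set_scope.
Local Open Scope ring_scope.

(* [V] is meant to be finite-dimensional: there, [x |-> 'd f x] is of class C^k
   iff [x |-> 'd f x v] is for every vector [v]. *)
Fixpoint Ck_on (R : realType) (V W : normedModType R) (k : nat)
    (U : set V) (f : V -> W) : Prop :=
  if k is k'.+1 then
    (forall x, U x -> differentiable f x) /\
    (forall v, Ck_on k' U (fun x => 'd f x v))
  else {within U, continuous f}.

Definition smooth_on (R : realType) (V W : normedModType R)
    (U : set V) (f : V -> W) : Prop :=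
  open U /\ forall k, Ck_on k U f.

(* Only the values of [chart_map] on [chart_dom], and those of [chart_inv] on
   the image of [chart_dom], are relevant. *)
Record chart (R : realType) (M : topologicalType) (m : nat) := Chart {
  chart_dom : set M ;
  chart_map : M -> 'rV[R]_m ;
  chart_inv : 'rV[R]_m -> M ;
  chart_dom_open : open chart_dom ;
  chart_img_open : open (chart_map @` chart_dom) ;
  chart_mapK : forall p, chart_dom p -> chart_inv (chart_map p) = p ;
  chart_map_continuous : {within chart_dom, continuous chart_map} ;
  chart_inv_continuous :
    {within chart_map @` chart_dom, continuous chart_inv} }.

Definition transition (R : realType) (M : topologicalType) (m : nat)
    (c c' : chart R M m) : 'rV[R]_m -> 'rV[R]_m :=
  chart_map c' \o chart_inv c.

(* The smooth structure is the one generated by [atlas], which need not be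
   maximal. *)
Record smooth_manifold (R : realType) (M : topologicalType) (m : nat) :=
  SmoothManifold {
    manifold_hausdorff : hausdorff_space M ;
    manifold_second_countable : @second_countable M ;
    atlas : set (chart R M m) ;
    atlas_cover : forall p : M, exists c, atlas c /\ chart_dom c p ;
    atlas_compatible : forall c c', atlas c -> atlas c' ->
      smooth_on (chart_map c @` (chart_dom c `&` chart_dom c'))
                (transition c c') }.

Definition chart_at (R : realType) (M : topologicalType) (m : nat)
    (S : smooth_manifold R M m) (p : M) : chart R M m :=
  projT1 (cid (atlas_cover S p)).

(* A tensor field of type (0,2) is given by its components: [metric c p] is the
   matrix of [g_p] in the coordinate basis of the chart [c]. Tangent vectors are
   row vectors, and a vector with coordinates [v] in [c] has coordinates
   [v *m jacobian (transition c c') (chart_map c p)] in [c']. *)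
Record riemannian_metric (R : realType) (M : topologicalType) (m : nat)
    (S : smooth_manifold R M m) := RiemannianMetric {
  metric :> chart R M m -> M -> 'M[R]_m ;
  metric_smooth : forall c, atlas S c -> forall i j : 'I_m,
    smooth_on (chart_map c @` chart_dom c)
              (fun u => metric c (chart_inv c u) i j : R^o) ;
  metric_change : forall c c' p, atlas S c -> atlas S c' ->
    chart_dom c p -> chart_dom c' p ->
    let J := jacobian (transition c c') (chart_map c p) in
    metric c p = J *m metric c' p *m J^T ;
  metric_sym : forall c p, atlas S c -> chart_dom c p ->
    (metric c p)^T = metric c p ;
  metric_posdef : forall c p, atlas S c -> chart_dom c p ->
    forall v : 'rV[R]_m, v != 0 -> 0 < (v *m metric c p *m v^T) 0 0 }.

Definition smooth_curve_at (R : realType) (M : topologicalType) (m : nat)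
    (S : smooth_manifold R M m) (c : R -> M) (t : R) : Prop :=
  exists k : chart R M m, exists U : set R^o,
    [/\ atlas S k, U t, (forall s, U s -> chart_dom k (c s)) &
        smooth_on U (chart_map k \o c : R^o -> 'rV[R]_m)].

(* [c] is a piecewise smooth curve segment on [a, b]: on each of finitely many
   closed subintervals it coincides with a curve which is smooth on a
   neighbourhood of that subinterval. The values of [c] outside [a, b] are
   irrelevant. *)
Definition curve_segment (R : realType) (M : topologicalType) (m : nat)
    (S : smooth_manifold R M m) (a b : R) (c : R -> M) : Prop :=
  a < b /\
  exists2 s : seq R, itv_partition a b s &
    forall i, (i < size s)%N ->
      exists2 e : R -> M,
        {in `[nth b (a :: s) i, nth b (a :: s) i.+1],
           forall t, smooth_curve_at S e t} &
        {in `[nth b (a :: s) i, nth b (a :: s) i.+1],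
           forall t, c t = e t}.

(* [g_{c(t)}(c'(t), c'(t))^{1/2}], which does not depend on the chart at the
   points where [c] is differentiable, hence everywhere on [a, b] but at
   finitely many points if [c] is a curve segment on [a, b]. *)
Definition speed (R : realType) (M : topologicalType) (m : nat)
    (S : smooth_manifold R M m) (g : riemannian_metric S)
    (c : R -> M) (t : R) : R :=
  let k := chart_at S (c t) in
  let v : 'rV[R]_m := derive1 (chart_map k \o c) t in
  Num.sqrt ((v *m g k (c t) *m v^T) 0 0).

Definition curve_length (R : realType) (M : topologicalType) (m : nat)
    (S : smooth_manifold R M m) (g : riemannian_metric S)
    (a b : R) (c : R -> M) : R :=
  \int[@lebesgue_measure R]_(t in `[a, b]) speed g c t.

Definition riemannian_dist (R : realType) (M : topologicalType) (m : nat)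
    (S : smooth_manifold R M m) (g : riemannian_metric S) (x y : M) : R :=
  inf [set L : R | exists a b (c : R -> M),
    [/\ curve_segment S a b c, c a = x, c b = y & L = curve_length g a b c]].

Definition locally_uniformly_continuous (R : realType) (M : topologicalType)
    (d : M -> M -> R) (f : M -> R) : Prop :=
  forall z : M, exists2 U : set M, nbhs z U &
    forall e : R, 0 < e -> exists2 delta : R, 0 < delta &
      forall x y, U x -> U y -> d x y < delta -> `|f x - f y| < e.

Definition modification (R : realType) (d : measure_display)
    (Omega : measurableType d) (P : probability Omega R) (M : Type)
    (phi psi : M -> {RV P >-> R}) : Prop :=
  forall x, P [set w | psi x w = phi x w] = 1%E.

Definition log2 (R : realType) (x : R) : R := ln x / ln 2.

Definition r_fun (R : realType) (beta h : R) : R :=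
  if h == 0 then 0 else log2 h^-1 `^ (- beta).

Definition q_fun (R : realType) (K alpha : R) (m : nat) (h : R) : R :=
  if h == 0 then 0 else K * log2 h^-1 `^ (- alpha) * h ^+ m.

(* Main.v *)
Require Import Defs.
From HB Require Import structures.
From mathcomp Require Import all_boot all_order all_algebra.
From mathcomp Require Import all_classical all_reals all_analysis measurable_realfun.
From mathcomp Require Import ring lra zify.
Import Order.TTheory GRing.Theory Num.Theory.
Import numFieldNormedType.Exports.
Set Implicit Arguments.
Unset Strict Implicit.
Unset Printing Implicit Defensive.
Local Open Scope classical_set_scope.
Local Open Scope ring_scope.

(** The theorem is a Kolmogorov-Chentsov criterion, localized in charts.

    A chart around a point is bi-Lipschitz, on a small ball, between the sup norm of
    the coordinates and the Riemannian distance (lemma [riemannian_dist_coord]). The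
    distance is at most a multiple of the coordinate distance because coordinate
    segments are curves of controlled length. It is at least a multiple of the
    coordinate distance because the coordinate distance to a point, truncated so that
    it is constant far from that point, grows along every curve no faster than a
    multiple of its length, whether or not the curve stays in the chart.

    In coordinates this is a statement about a field on the unit cube of dimension
    $m$, for which increments over distance $2^{-n}$ exceed $(n+1)^{-\beta}$ with
    probability at most a multiple of $(n+1)^{-\alpha} 2^{-nm}$. The dyadic grid of
    level $n$ has about $2^{nm}$ pairs of adjacent nodes, so by a union bound, the
    convergence of the series of $n^{-\alpha}$ and the Borel-Cantelli lemma, almost
    surely all increments between adjacent nodes are at most $(n+1)^{-\beta}$ from
    some level on. As the series of $n^{-\beta}$ converges too, the values along the
    dyadic approximations of a point converge uniformly, and the limit is a uniformly
    continuous modification on the cube (lemma [chaining_modification]).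

    Finally, a second countable space is covered by countably many of these cubes,
    and local modifications with continuous paths agree, off one null set, on all
    overlaps (lemma [glue_modifications]). *)

(** * Series and the Borel-Cantelli lemma *)

(** Cauchy condensation: the block of the $2^n$ terms that start at index $2^n - 1$
    is at most $(2^{1-a})^n$, so the series is dominated by a geometric one. *)
Lemma is_cvg_series_powR (R : realType) (a : R) : 1 < a ->
  cvgn (series (fun n => n.+1%:R `^ (- a) : R)).
Proof.
move=> a1; set u := fun n => _.
have u0 n : 0 <= u n by exact: powR_ge0.
have nd : nondecreasing_seq (series u) by apply: nondecreasing_series => n _ _.
pose z : R := 2 `^ (1 - a).
have z0 : 0 <= z by exact: powR_ge0.
have z1 : z < 1.
  rewrite /z -[1 - a]opprB powRN invf_lt1 ?powR_gt0//.
  rewrite -[ltLHS](congr1 (fun f => f (a - 1)) (powR1 R)).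
  by apply: gt0_ltr_powR; rewrite ?nnegrE ?subr_gt0 ?ltr1n.
have block n : \sum_((2 ^ n).-1 <= k < (2 ^ n).-1 + 2 ^ n) u k <= z ^+ n.
  apply: (@le_trans _ _ (\sum_((2 ^ n).-1 <= k < (2 ^ n).-1 + 2 ^ n) (2 ^ n)%N%:R `^ (- a))).
    rewrite !big_nat; apply: ler_sum => k /andP[kn _].
    rewrite /u !powRN lef_pV2 ?posrE ?powR_gt0 ?ltr0n ?expn_gt0//.
    apply: ge0_ler_powR; rewrite ?nnegrE ?ler0n//; first by lra.
    by rewrite ler_nat -(prednK (expn_gt0 2 n)) ltnS.
  rewrite sumr_const_nat addnC addnK -[leLHS]mulr_natl natrX le_eqVlt; apply/orP; left.
  have N0 : 0 < 2 ^+ n :> R by rewrite exprn_gt0.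
  rewrite -{1}(powRr1 (ltW N0)) -powRD; last by rewrite (gt_eqF N0) implybT.
  by rewrite -[2 ^+ n]powR_mulrn// -powR_mulrn// /z powRAC.
have bnd n : series u (2 ^ n).-1 <= series (fun k => z ^+ k) n.
  elim: n => [|n IH]; first by rewrite expn0 /series /= !big_geq.
  have -> : (2 ^ n.+1).-1 = ((2 ^ n) + (2 ^ n).-1)%N.
    by rewrite expnS mul2n -addnn -!subn1 addnBA ?expn_gt0.
  rewrite series_addn seriesSr; apply: lerD => //.
  by rewrite addnC; exact: block.
have zc : cvgn (series (fun k => z ^+ k)).
  have -> : (fun k => z ^+ k) = geometric 1 z.
    by apply/funext => n; rewrite /geometric/= mul1r.
  by apply: is_cvg_geometric_series; rewrite ger0_norm.
apply: nondecreasing_is_cvgn => //.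
exists (limn (series (fun k => z ^+ k))) => _ [n _ <-].
apply: (le_trans (nd n (2 ^ n).-1 _)).
  by rewrite -ltnS (prednK (expn_gt0 2 n)) ltn_expl.
apply: (le_trans (bnd n)); apply: nondecreasing_cvgn_le => //.
by apply: nondecreasing_series => k _ _; exact: exprn_ge0.
Qed.

(** The bound on the distance to the limit depends on [a] only; this is what makes
    the limits along the chains uniform in the point. *)
Lemma summable_steps_cvg (R : realType) (x a : nat -> R) N :
  (forall n, (N <= n)%N -> `|x n.+1 - x n| <= a n) -> cvgn (series a) ->
  cvgn x /\
  forall n, (N <= n)%N -> `|limn x - x n| <= limn (series a) - series a n.
Proof.
move=> xa ca.
have step n p : (N <= n)%N -> `|x (n + p)%N - x n| <= series a (n + p)%N - series a n.
  move=> Nn; elim: p => [|p IH]; first by rewrite addn0 !subrr normr0.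
  rewrite addnS seriesSr.
  apply: le_trans (ler_distD (x (n + p)%N) _ _) _.
  have := xa (n + p)%N (leq_trans Nn (leq_addr _ _)).
  by move: IH; lra.
have cx : cvgn x.
  apply/cauchy_cvgP/cauchy_exP => e e0.
  have /cvgrPdist_lt/(_ (e / 2)) := ca.
  rewrite divr_gt0// => /(_ isT)[n0 _ n0P].
  pose n := maxn N n0; exists (x n); exists n => // p /= np.
  rewrite -(subnKC np) /ball/= distrC.
  apply: le_lt_trans (step _ _ (leq_maxl _ _)) _.
  have := n0P n (leq_maxr _ _); have := n0P (n + (p - n))%N.
  rewrite /= (leq_trans (leq_maxr N n0) (leq_addr _ _)) => /(_ isT).
  by rewrite !ltr_norml => /andP[? ?] /andP[? ?]; lra.
split => // n Nn.
have : `|x p - x n| @[p --> \oo] --> `|limn x - x n|.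
  by apply: cvg_norm; apply: cvgB => //; exact: cvg_cst.
have : series a p - series a n @[p --> \oo] --> limn (series a) - series a n.
  by apply: cvgB => //; exact: cvg_cst.
move=> h1 h2; apply: (ler_cvg_to h2 h1).
by exists n => // p /= np; rewrite -(subnKC np); exact: step.
Qed.

Lemma measure_bigsetU_le d (T : measurableType d) (R : realType)
    (mu : {measure set T -> \bar R}) (I : Type) (s : seq I) (A : I -> set T) :
  (forall i, measurable (A i)) ->
  (mu (\big[setU/set0]_(i <- s) A i) <= \sum_(i <- s) mu (A i))%E.
Proof.
move=> mA; elim: s => [|i s IH]; first by rewrite !big_nil measure0.
rewrite !big_cons; apply: (le_trans (measureU2 _ _ _)) => //.
  exact: bigsetU_measurable.
exact: leeD2l.
Qed.

Lemma Borel_Cantelli_real d (T : measurableType d) (R : realType)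
    (mu : {measure set T -> \bar R}) (A : nat -> set T) (b : nat -> R) :
  (forall n, measurable (A n)) -> (forall n, (mu (A n) <= (b n)%:E)%E) ->
  cvgn (series b) ->
  exists2 N : set T, measurable N /\ mu N = 0%E &
    forall w, ~ N w -> exists n0, forall n, (n0 <= n)%N -> ~ A n w.
Proof.
move=> mA Ab cb; exists (lim_sup_set A).
  split; first by apply: bigcap_measurable => // k _; exact: bigcup_measurable.
  apply: lim_sup_set_cvg0 => //.
  apply: (@le_lt_trans _ _ (\sum_(n <oo) (b n)%:E)%E).
    by apply: lee_nneseries => n _ //; rewrite ?measure_ge0.
  rewrite (_ : (fun n => _) = EFin \o series b); last first.
    by apply/funext => n /=; rewrite sumEFin.
  by rewrite EFin_lim// ltry.
move=> w; apply: contra_notP => /forallNP h n _.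
apply: contrapT => hn; apply: (h n) => k nk Akw.
by apply: hn; exists k.
Qed.

(** * Dyadic approximation in the unit cube *)

Lemma rV_norm_leP (R : realType) m (v : 'rV[R]_m) (e : R) : 0 <= e ->
  (`|v| <= e) <-> (forall i, `|v 0 i| <= e).
Proof.
move=> e0; rewrite [`|v|]mx_normrE; split.
  by move=> /bigmax_leP[_ h] i; exact: (h (0, i)).
move=> h; apply/bigmax_leP; split => // -[j i] _ /=.
by rewrite (ord1 j).
Qed.

Lemma rV_coord_le (R : realType) m (v : 'rV[R]_m) i : `|v 0 i| <= `|v|.
Proof. exact: (rV_norm_leP v (normr_ge0 v)).1. Qed.

Definition unit_cube (R : realType) m : set 'rV[R]_m :=
  [set u | forall i, 0 <= u 0 i <= 1].

Definition dyadic_floor (R : realType) m n (u : 'rV[R]_m) : 'rV[R]_m :=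
  \row_i ((Num.floor (2 ^+ n * u 0 i))%:~R / 2 ^+ n).

Lemma floor_bounds (R : realType) (x : R) :
  (Num.floor x)%:~R <= x < (Num.floor x)%:~R + 1.
Proof. by have := floor_itv x; rewrite intrD mulr1z. Qed.

Section dyadic_grid.
Variables (R : realType) (m : nat).
Implicit Types u v : 'rV[R]_m.

Lemma dyadic_floor_cube n u : unit_cube u -> unit_cube (dyadic_floor n u).
Proof.
move=> cu i; rewrite mxE; have /andP[u0 u1] := cu i.
have p0 : 0 < 2 ^+ n :> R by rewrite exprn_gt0.
apply/andP; split.
  by rewrite divr_ge0 ?(ltW p0)// ler0z floor_ge0 mulr_ge0// ltW.
rewrite ler_pdivrMr// mul1r; apply: le_trans (floor_le _) _.
by rewrite ler_piMr// ltW.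
Qed.

Lemma dyadic_floor_dist n u : `|dyadic_floor n u - u| <= 2 ^- n.
Proof.
have p0 : 0 < 2 ^+ n :> R by rewrite exprn_gt0.
apply/rV_norm_leP => [|i]; first by rewrite invr_ge0 ltW.
rewrite !mxE; set x := Num.floor _.
have -> : x%:~R / 2 ^+ n - u 0 i = (x%:~R - 2 ^+ n * u 0 i) / 2 ^+ n.
  by field; rewrite gt_eqF.
rewrite normrM [X in _ * X]gtr0_norm ?invr_gt0// ler_piMl ?invr_ge0 ?(ltW p0)//.
rewrite ler_norml; have /andP[] := floor_bounds (2 ^+ n * u 0 i).
by rewrite -/x; lra.
Qed.

(** Rounding down is monotone and commutes with unit translations, so it does not
    separate points at distance one grid step by more than one step. *)
Lemma dyadic_floor_near n u v : `|u - v| <= 2 ^- n ->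
  `|dyadic_floor n u - dyadic_floor n v| <= 2 ^- n.
Proof.
have p0 : 0 < 2 ^+ n :> R by rewrite exprn_gt0.
have q0 : 0 <= 2 ^- n :> R by rewrite invr_ge0 ltW.
move=> /(rV_norm_leP _ q0) uv; apply/rV_norm_leP => // i.
have := uv i; rewrite !mxE -mulrBl normrM [X in _ * X]gtr0_norm ?invr_gt0// => uvi.
rewrite ler_piMl// -rmorphB /= -intr_norm -[1](mulr1z 1) ler_int.
have [h1 h2] : 2 ^+ n * u 0 i <= 2 ^+ n * v 0 i + 1 /\ 2 ^+ n * v 0 i <= 2 ^+ n * u 0 i + 1.
  have : 2 ^+ n * `|u 0 i - v 0 i| <= 1.
    by rewrite -ler_pdivlMl ?mulr1.
  rewrite -[X in X * _](gtr0_norm p0) -normrM mulrBr ler_norml => /andP[].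
  by split; lra.
have /andP[a1 a2] := floor_bounds (2 ^+ n * u 0 i).
have /andP[b1 b2] := floor_bounds (2 ^+ n * v 0 i).
move: a1 a2 b1 b2; set x := Num.floor _; set y := Num.floor _ => a1 a2 b1 b2.
have : x%:~R < (y + 2)%:~R :> R by rewrite intrD /=; lra.
have : y%:~R < (x + 2)%:~R :> R by rewrite intrD /=; lra.
rewrite !ltr_int; lia.
Qed.

Lemma dyadic_floor_floor n u :
  dyadic_floor n.+1 (dyadic_floor n u) = dyadic_floor n u.
Proof.
apply/rowP => i; rewrite !mxE; set x := Num.floor (2 ^+ n * _).
have p0 : 2 ^+ n != 0 :> R by rewrite gt_eqF ?exprn_gt0.
rewrite (_ : 2 ^+ n.+1 * _ = (2 * x)%:~R) ?intrKfloor; last first.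
  by rewrite intrM exprS; field.
by rewrite intrM exprS; field.
Qed.

(** The level $n$ approximation is itself a node of level $n+1$: a step of the
    chain is therefore an increment between adjacent nodes of one level. *)
Lemma dyadic_floor_succ n u :
  `|dyadic_floor n.+1 (dyadic_floor n u) - dyadic_floor n.+1 u| <= 2 ^- n.+1.
Proof.
have p0 : 0 < 2 ^+ n.+1 :> R by rewrite exprn_gt0.
rewrite dyadic_floor_floor.
apply/rV_norm_leP => [|i]; first by rewrite invr_ge0 ltW.
rewrite !mxE.
have := floor_bounds (2 ^+ n * u 0 i); have := floor_bounds (2 ^+ n.+1 * u 0 i).
set x := Num.floor (2 ^+ n * _); set y := Num.floor (2 ^+ n.+1 * _).
move=> /andP[y1 y2] /andP[x1 x2].
have -> : x%:~R / 2 ^+ n - y%:~R / 2 ^+ n.+1 = (2 * x - y)%:~R / 2 ^+ n.+1 :> R.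
  by rewrite intrB intrM exprS; field; rewrite gt_eqF ?exprn_gt0.
rewrite normrM [X in _ * X]gtr0_norm ?invr_gt0//.
rewrite ler_piMl ?invr_ge0 ?(ltW p0)// -intr_norm -[1](mulr1z 1) ler_int.
rewrite exprS -mulrA in y1 y2.
have : y%:~R < (2 * x + 2)%:~R :> R by rewrite intrD intrM /=; lra.
have : (2 * x)%:~R < (y + 1)%:~R :> R by rewrite intrD intrM /=; lra.
rewrite !ltr_int; lia.
Qed.

Definition dyadic_node n (k : {ffun 'I_m -> 'I_(2 ^ n).+1}) : 'rV[R]_m :=
  \row_i ((k i)%:R / 2 ^+ n).

(** Adjacent nodes are coded by a node and one of the $3^m$ displacements, which
    makes the number of pairs linear, not quadratic, in the number of nodes; the
    point coded may lie outside the cube. *)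
Definition dyadic_neighbour n
    (kd : {ffun 'I_m -> 'I_(2 ^ n).+1} * {ffun 'I_m -> 'I_3}) : 'rV[R]_m :=
  \row_i (((kd.1 i)%:R + (kd.2 i)%:R - 1) / 2 ^+ n).

Lemma dyadic_pair n u v : unit_cube u -> unit_cube v ->
  `|dyadic_floor n u - dyadic_floor n v| <= 2 ^- n ->
  exists kd : {ffun 'I_m -> 'I_(2 ^ n).+1} * {ffun 'I_m -> 'I_3},
    dyadic_floor n u = dyadic_node kd.1 /\ dyadic_floor n v = dyadic_neighbour kd.
Proof.
move=> cu cv; have p0 : 0 < 2 ^+ n :> R by rewrite exprn_gt0.
have q0 : 0 <= 2 ^- n :> R by rewrite invr_ge0 ltW.
move=> /(rV_norm_leP _ q0) uv.
pose x i := Num.floor (2 ^+ n * u 0 i); pose y i := Num.floor (2 ^+ n * v 0 i).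
have x0 i : (0 <= x i)%R.
  by rewrite floor_ge0 mulr_ge0// ?(ltW p0)//; case/andP: (cu i).
have xn i : (x i <= (2 ^ n)%N%:Z)%R.
  rewrite -(ler_int R); apply: le_trans (floor_le _) _.
  by rewrite -pmulrn natrX ler_piMr// ?(ltW p0)//; case/andP: (cu i).
have xy i : (`|x i - y i| <= 1)%R.
  rewrite -(ler_int R) intr_norm.
  have := uv i; rewrite !mxE -mulrBl normrM [X in _ * X]gtr0_norm ?invr_gt0//.
  by rewrite -{2}[2 ^- n]mul1r ler_pM2r ?invr_gt0// rmorphB.
exists ([ffun i => inord (absz (x i))], [ffun i => inord (absz (y i - x i + 1)%R)]); split.
  apply/rowP => i; rewrite !mxE ffunE inordK; last by have := xn i; have := x0 i; lia.
  by congr (_ / _); rewrite natr_absz ger0_norm ?x0.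
apply/rowP => i; rewrite !mxE !ffunE !inordK; last 2 first.
- by have := xy i; lia.
- by have := xn i; have := x0 i; lia.
congr (_ / _); rewrite !natr_absz !ger0_norm ?x0//; last by have := xy i; lia.
rewrite -/(y i) -/(x i) intrD intrB /=; ring.
Qed.

End dyadic_grid.

(** * Chaining *)

Lemma RV_of_measurable d (T : measurableType d) (R : realType)
    (P : probability T R) (f : T -> R) :
  measurable_fun setT f -> exists Y : {RV P >-> R}, forall w, Y w = f w.
Proof.
by move=> mf; exists (mfun_Sub (mem_set mf)) => w; rewrite mfun_valP.
Qed.

Lemma measurable_RV_eq d (T : measurableType d) (R : realType)
    (P : probability T R) (Y Z : {RV P >-> R}) :
  measurable [set w | Y w = Z w].
Proof.
have mYZ : measurable_fun setT (fun w => Y w == Z w).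
  exact: measurable_fun_eqr.
rewrite -[X in measurable X]setTI.
have := mYZ measurableT [set true] I.
by congr measurable; apply/seteqP; split => w [_ /= /eqP].
Qed.

Lemma probability1_null_setC d (T : measurableType d) (R : realType)
    (P : probability T R) (A N : set T) :
  measurable A -> measurable N -> P N = 0%E -> ~` N `<=` A -> P A = 1%E.
Proof.
move=> mA mN PN NA.
have PA0 : P (~` A) = 0%E.
  apply/eqP; rewrite eq_le measure_ge0 andbT -PN le_measure ?inE//.
    exact: measurableC.
  by move=> w; apply: contra_notP => /NA.
by rewrite -(setCK A) probability_setC ?PA0 ?sube0//; exact: measurableC.
Qed.

Lemma measurable_RV_dist_gt d (T : measurableType d) (R : realType)
    (P : probability T R) (Y Z : {RV P >-> R}) (r : R) :
  measurable [set w | r < `|Y w - Z w|].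
Proof.
rewrite -[X in measurable X]setTI.
have mf : measurable_fun setT (fun w => `|Y w - Z w|).
  by apply: measurableT_comp => //; apply: measurable_funB.
have := mf measurableT _ (measurable_itv `]r, +oo[).
congr measurable; apply/seteqP; split => w /=; by rewrite in_itv/= andbT.
Qed.

Section chaining.
Variables (R : realType) (m : nat) (d : measure_display) (T : measurableType d).
Variables (P : probability T R) (X : 'rV[R]_m -> {RV P >-> R}).
Variables (a b : nat -> R).
Hypotheses (a0 : forall n, 0 <= a n) (b0 : forall n, 0 <= b n).
Hypotheses (ca : cvgn (series a)) (cb : cvgn (series b)).
Hypothesis X_increment : forall n u v, unit_cube u -> unit_cube v ->
  `|u - v| <= 2 ^- n ->
  (P [set w | (a n < `|X u w - X v w|)%R] <= (b n / 2 ^+ (n * m))%:E)%E.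

(* Codes whose second point is outside the cube, or that are not of adjacent
   nodes, contribute the empty event. *)
Let bad n (kd : {ffun 'I_m -> 'I_(2 ^ n).+1} * {ffun 'I_m -> 'I_3}) : set T :=
  let p := dyadic_node R kd.1 in let q := dyadic_neighbour R kd in
  if `[< [/\ unit_cube p, unit_cube q & `|p - q| <= 2 ^- n] >]
  then [set w | a n < `|X p w - X q w|] else set0.

Let bad_level n : set T := \big[setU/set0]_kd @bad n kd.

Let mbad n kd : measurable (@bad n kd).
Proof.
by rewrite /bad; case: ifP => // _; exact: measurable_RV_dist_gt.
Qed.

(* Level $n$ has at most $6^m 2^{nm}$ codes, and this count is absorbed by the
   factor $2^{-nm}$ of the increment bound. *)
Let bad_level_le n : (P (bad_level n) <= (6 ^+ m * b n)%:E)%E.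
Proof.
apply: le_trans (measure_bigsetU_le _ _ _) _; first exact: mbad.
apply: (@le_trans _ _ (\sum_(kd : {ffun 'I_m -> 'I_(2 ^ n).+1} *
    {ffun 'I_m -> 'I_3}) (b n / 2 ^+ (n * m))%:E)%E).
  apply: lee_sum => kd _; rewrite /bad; case: ifPn => [/asboolP[pc qc pq]|_].
    exact: X_increment.
  by rewrite measure0 lee_fin divr_ge0.
rewrite sumEFin lee_fin sumr_const card_prod !card_ffun !card_ord.
have p0 : 0 < 2 ^+ (n * m) :> R by rewrite exprn_gt0.
rewrite -[leLHS]mulr_natl natrM !natrX mulrA ler_pdivrMr// [leRHS]mulrAC.
rewrite ler_wpM2r// exprM -!exprMn lerXn2r ?nnegrE ?mulr_ge0 ?ler0n ?exprn_ge0//.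
rewrite -natr1 natrX.
have : 1 <= 2 ^+ n :> R by rewrite exprn_ege1// ler1n.
lra.
Qed.

Let not_bad n u v w : unit_cube u -> unit_cube v ->
  `|dyadic_floor n u - dyadic_floor n v| <= 2 ^- n -> ~ bad_level n w ->
  `|X (dyadic_floor n u) w - X (dyadic_floor n v) w| <= a n.
Proof.
move=> cu cv uv nb; rewrite leNgt; apply/negP => gt; apply: nb.
have [kd [eu ev]] := dyadic_pair cu cv uv.
rewrite /bad_level (bigD1 kd)//=; left.
by rewrite /bad -eu -ev asboolT//; split => //; exact: dyadic_floor_cube.
Qed.

(** The modification is the limit of the field along the dyadic approximations of
    each point. By Borel-Cantelli, almost surely all increments between adjacent
    nodes of level $n$ are at most $a_n$ from some level on, and then all the limits
    exist with an error controlled by the tail of the series of $a$. A second use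
    of Borel-Cantelli, at a fixed point, identifies the limit with the value of the
    field there. On the exceptional null set the modification is zero. *)
Lemma chaining_modification : exists Y : 'rV[R]_m -> {RV P >-> R},
  (forall u, unit_cube u -> P [set w | Y u w = X u w] = 1%E) /\
  forall w (e : R), 0 < e -> exists2 delta, 0 < delta &
    forall u v, unit_cube u -> unit_cube v -> `|u - v| < delta ->
      `|Y u w - Y v w| < e.
Proof.
pose a' n := a n.+1.
have ca' : cvgn (series a').
  rewrite (_ : series a' = fun n => series a n.+1 - a 0).
    by apply: is_cvgB; [apply/cvg_ex; case/cvg_ex: ca => l al; exists l;
      rewrite (cvg_shiftS (series a))|exact: is_cvg_cst].
  by apply/funext => n; rewrite /series/= [in RHS]big_nat_recl// [a 0 + _]addrC addrK.
pose tail n := limn (series a') - series a' n.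
have tail0 : tail n @[n --> \oo] --> 0.
  by rewrite -(subrr (limn (series a'))); apply: cvgB => //; exact: cvg_cst.
have a_cvg0 : a n @[n --> \oo] --> 0 by exact: cvg_series_cvg_0.
have [||N [mN PN0] Ngood] := @Borel_Cantelli_real _ T R P bad_level _ _ bad_level_le.
- by move=> n; apply: bigsetU_measurable => kd _; exact: mbad.
- rewrite (_ : series _ = fun n => 6 ^+ m * series b n).
    by apply: is_cvgM => //; exact: is_cvg_cst.
  by apply/funext => n; rewrite /series/= mulr_sumr.
pose x u n (w : T) : R := X (dyadic_floor n u) w.
have chain w : ~ N w -> exists n0,
    (forall n u v, (n0 <= n)%N -> unit_cube u -> unit_cube v ->
      `|u - v| <= 2 ^- n -> `|x u n w - x v n w| <= a n) /\
    forall u, unit_cube u -> cvgn (x u ^~ w) /\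
    forall n, (n0 <= n)%N -> `|limn (x u ^~ w) - x u n w| <= tail n.
  move=> /Ngood[n0 n0P]; exists n0; split.
    move=> n u v nn cu cv uv; apply: not_bad => //; last exact: n0P.
    exact: dyadic_floor_near.
  move=> u cu; apply: summable_steps_cvg => // n nn.
  rewrite /x distrC -(dyadic_floor_floor n u).
  apply: not_bad => //; first exact: dyadic_floor_cube.
    exact: dyadic_floor_succ.
  by apply: n0P; exact: leq_trans nn _.
(* The indicator makes the defining sequence converge everywhere, which gives
   the measurability of the limit. *)
pose y u w := \1_(~` N) w * (if `[< unit_cube u >] then limn (x u ^~ w) else 0).
have my u : measurable_fun setT (y u).
  have [cu|ncu] := pselect (unit_cube u); last first.
    rewrite (_ : y u = cst 0)//; apply/funext => w.
    by rewrite /y asboolF// mulr0.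
  rewrite /y asboolT//.
  apply: (@measurable_fun_cvg _ _ _ _ (fun n w => \1_(~` N) w * x u n w)).
    move=> n; apply: measurable_funM => //.
    exact/measurable_indic/measurableC.
  move=> w _; have [Nw|Nw] := pselect (N w).
    rewrite indicE (_ : w \in ~` N = false) ?mul0r; last first.
      by apply: memNset; exact.
    by under eq_fun do rewrite mul0r; exact: cvg_cst.
  have [n0 [_ /(_ u cu)[cx _]]] := chain w Nw.
  by apply: cvgM => //; exact: cvg_cst.
have /choice[Y YE] : forall u, exists Z : {RV P >-> R}, forall w, Z w = y u w.
  by move=> u; exact: RV_of_measurable.
exists Y; split => [u cu|w e e0].
  have [|||N' [mN' PN'0] N'good] := @Borel_Cantelli_real _ T R P
      (fun n => [set w | a n < `|x u n w - X u w|]) b.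
  - by move=> n; exact: measurable_RV_dist_gt.
  - move=> n; apply: le_trans (X_increment _ _ _) _ => //.
    + exact: dyadic_floor_cube.
    + exact: dyadic_floor_dist.
    rewrite lee_fin ler_pdivrMr ?exprn_gt0// ler_peMr//.
    by rewrite exprn_ege1// ler1n.
  - exact: cb.
  apply: (probability1_null_setC _ (measurableU _ _ mN mN')).
  - exact: measurable_RV_eq.
  - by apply: null_set_setU => //.
  move=> w /not_orP[Nw N'w] /=.
  rewrite YE /y asboolT// indicE mem_set// mul1r.
  apply/cvg_lim => //; apply/cvgrPdist_lt => e e0.
  have [n0 n0P] := N'good w N'w.
  near=> n; rewrite distrC.
  apply: (@le_lt_trans _ _ (a n)).
    by rewrite leNgt; apply/negP/n0P; near: n; exact: nbhs_infty_ge.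
  by rewrite -[a n]ger0_norm//; near: n; exact: (cvgr0_norm_lt _ a_cvg0).
have [Nw|Nw] := pselect (N w).
  exists 1 => // u v _ _ _; rewrite !YE /y indicE (_ : w \in ~` N = false).
    by rewrite !mul0r subrr normr0.
  by apply: memNset; exact.
have [n0 [incr lims]] := chain w Nw.
(* Two tails for the chains of the two points, and one increment between their
   nodes of level $n$, which are adjacent. *)
have e4 : 0 < e / 4 by rewrite divr_gt0.
near \oo => n.
have n0n : (n0 <= n)%N by near: n; exact: nbhs_infty_ge.
have tn : `|tail n| < e / 4 by near: n; exact: (cvgr0_norm_lt _ tail0).
have an : `|a n| < e / 4 by near: n; exact: (cvgr0_norm_lt _ a_cvg0).
exists (2 ^- n); first by rewrite invr_gt0 exprn_gt0.
move=> u v cu cv uv; rewrite !YE /y !asboolT// indicE mem_set// !mul1r.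
have := (lims u cu).2 n n0n; have := (lims v cv).2 n n0n.
have := incr n u v n0n cu cv (ltW uv).
move: tn an; rewrite !ltr_norml !ler_norml.
move: (limn _) (limn _) => p q.
by move=> /andP[? ?] /andP[? ?] /andP[? ?] /andP[? ?] /andP[? ?]; lra.
Unshelve. all: by end_near. Qed.

End chaining.

(** * Gluing local modifications *)

Definition uniform_modification_on (R : realType) (M : topologicalType)
    (dist : M -> M -> R) d (T : measurableType d) (P : probability T R)
    (phi psi : M -> {RV P >-> R}) (U : set M) : Prop :=
  [/\ forall x, U x -> P [set w | psi x w = phi x w] = 1%E,
      forall w x, U x -> {for x, continuous (psi ^~ w)} &
      forall w (e : R), 0 < e -> exists2 delta : R, 0 < delta &
        forall x y, U x -> U y -> dist x y < delta -> `|psi x w - psi y w| < e].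

Lemma uniform_modification_onS (R : realType) (M : topologicalType)
    (dist : M -> M -> R) d (T : measurableType d) (P : probability T R)
    (phi psi : M -> {RV P >-> R}) (U V : set M) : V `<=` U ->
  uniform_modification_on dist phi psi U ->
  uniform_modification_on dist phi psi V.
Proof.
move=> VU [h1 h2 h3]; split => [x /VU/h1//|w x /VU/h2//|w e /(h3 w)[del d0 h]].
by exists del => // x y /VU Ux /VU Uy; exact: h.
Qed.

Lemma second_countable_seq (M : topologicalType) : @second_countable M ->
  exists E : nat -> set M, forall (x : M) (U : set M), nbhs x U ->
    exists n, [/\ open (E n), E n x & E n `<=` U].
Proof.
move=> [B /countable_injP[f finj] [Bop Bbase]].
exists (fun n => xget set0 [set C | B C /\ f C = n]) => x U xU.
have [C [BC Cx] CU] := Bbase x U xU.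
exists (f C); rewrite (_ : xget _ _ = C).
  by split => //; exact: Bop.
case: xgetP => [D _ [BD fD]|/(_ C)]; last by case.
by apply: finj => //; exact/mem_set.
Qed.

Lemma null_RV_neq d (T : measurableType d) (R : realType)
    (P : probability T R) (Y Z : {RV P >-> R}) :
  P [set w | Y w = Z w] = 1%E -> P.-negligible [set w | Y w <> Z w].
Proof.
move=> YZ1; have mYZ := measurable_RV_eq Y Z.
exists (~` [set w | Y w = Z w]); split => //; first exact: measurableC.
by rewrite probability_setC// YZ1 subee.
Qed.

(** On an overlap two local modifications agree almost surely at each point of a
    countable dense set, hence, by continuity of their paths, almost surely at all
    points of the overlap at once. With countably many pieces there is one null set
    off which all pieces agree; on it the global field is put to zero. *)
Lemma glue_modifications (R : realType) (M : topologicalType)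
    (scM : @second_countable M) (dist : M -> M -> R)
    d (T : measurableType d) (P : probability T R) (phi : M -> {RV P >-> R}) :
  (forall z, exists U psi,
    [/\ open U, U z & uniform_modification_on dist phi psi U]) ->
  exists psi : M -> {RV P >-> R}, modification phi psi /\
    forall w, locally_uniformly_continuous dist (psi ^~ w).
Proof.
move=> loc; have [E Ebase] := second_countable_seq scM.
(* Shrinking the local domains to members of the countable basis makes the cover
   countable, and [D] picks a dense sequence of points. *)
pose good i := open (E i) /\ exists psi, uniform_modification_on dist phi psi (E i).
have cover z : exists i, good i /\ E i z.
  have [U [psi [oU Uz Upsi]]] := loc z.
  have [i [oE Ez EU]] := Ebase z U (open_nbhs_nbhs (conj oU Uz)).
  exists i; split => //; split => //; exists psi.
  exact: uniform_modification_onS Upsi.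
have /choice[psi psiP] : forall i, exists psi,
    good i -> uniform_modification_on dist phi psi (E i).
  move=> i; have [[_ [psi h]]|ng] := pselect (good i); first by exists psi.
  by exists phi => /ng.
have /choice[D DP] : forall k, exists p : option M,
    if p is Some x then E k x else ~ exists x, E k x.
  move=> k; have [[x Ex]|nE] := pselect (exists x, E k x); first by exists (Some x).
  by exists None.
pose bad i j k := [set w | exists p,
  [/\ D k = Some p, good i, good j, E i p & E j p] /\ psi i p w <> psi j p w].
have bad_null i j k : P.-negligible (bad i j k).
  have [[p [Dk gi gj Ei Ej]]|no] :=
      pselect (exists p, [/\ D k = Some p, good i, good j, E i p & E j p]); last first.
    rewrite (_ : bad i j k = set0); first exact: negligible_set0.
    by apply/seteqP; split => // w [p [h _]]; apply: no; exists p.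
  have [mi _ _] := psiP i gi; have [mj _ _] := psiP j gj.
  have := negligibleU (null_RV_neq (mi p Ei)) (null_RV_neq (mj p Ej)).
  apply: negligibleS => w [q [[Dq _ _ _ _]]].
  have -> : q = p by move: Dq; rewrite Dk => -[].
  by apply: contra_notP => /not_orP[/contrapT -> /contrapT ->].
have [N [mN PN0 badN]] : P.-negligible (\bigcup_i \bigcup_j \bigcup_k bad i j k).
  by do 3 (apply: negligible_bigcup => ?); exact: bad_null.
have agree w i j x : ~ N w -> good i -> good j -> E i x -> E j x ->
    psi i x w = psi j x w.
  move=> Nw gi gj Ei Ej; apply: contrapT => neq; apply/Nw/badN.
  have [_ ci _] := psiP i gi; have [_ cj _] := psiP j gj.
  have nx : \forall y \near x, psi i y w - psi j y w != 0.
    apply: (@cvgr_neq0 _ _ _ (nbhs x) _ _ (psi i x w - psi j x w)).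
      by apply: cvgB; [exact: ci|exact: cj].
    by rewrite subr_eq0; exact/eqP.
  have Eix : nbhs x (E i) by apply: open_nbhs_nbhs; split => //; case: gi.
  have Ejx : nbhs x (E j) by apply: open_nbhs_nbhs; split => //; case: gj.
  (* Continuity spreads a disagreement to a basic open set, hence to its chosen
     point. *)
  have [k [_ Ekx kU]] := Ebase x _ (filterI nx (filterI Eix Ejx)).
  exists i => //; exists j => //; exists k => //.
  have := DP k; case Dk : (D k) => [p|] Ekp; last by case: Ekp; exists x.
  exists p; have [/= pne [Eip Ejp]] := kU p Ekp.
  by split => //; apply/eqP; rewrite -subr_eq0.
have /choice[ix ixP] := cover.
have /choice[Y YE] : forall x, exists Z : {RV P >-> R},
    forall w, Z w = \1_(~` N) w * psi (ix x) x w.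
  move=> x; apply: RV_of_measurable; apply: measurable_funM => //.
  exact/measurable_indic/measurableC.
have YN x w : ~ N w -> Y x w = psi (ix x) x w.
  by move=> Nw; rewrite YE indicE mem_set// mul1r.
exists Y; split => [x|w z].
  have [gx Ex] := ixP x; have [/(_ x Ex)/null_RV_neq[N' [mN' PN'0 subN']] _ _] := psiP _ gx.
  apply: (probability1_null_setC _ (measurableU _ _ mN mN')).
  - exact: measurable_RV_eq.
  - by apply: null_set_setU => //.
  move=> w /not_orP[Nw N'w] /=; rewrite YN//.
  by apply: contrapT => /subN'.
have [gz Ez] := ixP z.
exists (E (ix z)); first by apply: open_nbhs_nbhs; split => //; case: gz.
move=> e e0; have [Nw|Nw] := pselect (N w).
  exists 1 => // x y _ _ _; rewrite !YE indicE (_ : w \in ~` N = false).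
    by rewrite !mul0r subrr normr0.
  by apply: memNset; exact.
have [_ _ /(_ w e e0)[delta d0 deltaP]] := psiP _ gz.
exists delta => // x y Ex Ey xy; rewrite !YN//.
have [gx Exx] := ixP x; have [gy Eyy] := ixP y.
rewrite (agree w (ix x) (ix z) x)// (agree w (ix y) (ix z) y)//.
exact: deltaP.
Qed.

(** * Charts and speed of curves *)

Lemma near_eq_continuous_at (T U : topologicalType) (f g : T -> U) t :
  {near t, f =1 g} -> {for t, continuous f} -> {for t, continuous g}.
Proof.
move=> fg; rewrite /prop_for /continuous_at (nbhs_singleton fg).
by apply: cvg_trans; apply: near_eq_cvg; apply: filterS fg => s ->.
Qed.

Lemma smooth_on_differentiable (R : realType) (V W : normedModType R)
    (U : set V) (f : V -> W) x : smooth_on U f -> U x -> differentiable f x.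
Proof. by move=> [_ /(_ 1%N)[h _]]; exact: h. Qed.

Lemma smooth_on_continuous_diff (R : realType) (V W : normedModType R)
    (U : set V) (f : V -> W) x v : smooth_on U f -> U x ->
  {for x, continuous (fun y => 'd f y v)}.
Proof.
move=> [oU /(_ 1%N)[_ /(_ v)/=]].
by rewrite continuous_open_subspace// => h Ux; apply: h; exact/mem_set.
Qed.

Section charts.
Variables (R : realType) (M : topologicalType) (m : nat).
Implicit Types k : chart R M m.

Lemma chart_map_continuous_at k p : chart_dom k p ->
  {for p, continuous (chart_map k)}.
Proof.
move=> kp; have := @chart_map_continuous _ _ _ k.
rewrite continuous_open_subspace; last exact: chart_dom_open.
by apply; exact/mem_set.
Qed.

Lemma chart_inv_continuous_at k u : (chart_map k @` chart_dom k) u ->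
  {for u, continuous (chart_inv k)}.
Proof.
move=> ku; have := @chart_inv_continuous _ _ _ k.
rewrite continuous_open_subspace; last exact: chart_img_open.
by apply; exact/mem_set.
Qed.

Lemma chart_img_inv k u : (chart_map k @` chart_dom k) u ->
  chart_dom k (chart_inv k u) /\ chart_map k (chart_inv k u) = u.
Proof. by move=> [p kp <-]; rewrite chart_mapK. Qed.

Lemma chart_dom_nbhs k p : chart_dom k p -> nbhs p (chart_dom k).
Proof. by move=> kp; apply: open_nbhs_nbhs; split => //; exact: chart_dom_open. Qed.

End charts.

Definition quadratic_form (R : realType) m (A : 'M[R]_m) (v : 'rV[R]_m) : R :=
  (v *m A *m v^T) 0 0.

Lemma quadratic_formE (R : realType) m (A : 'M[R]_m) (v : 'rV[R]_m) :
  quadratic_form A v = \sum_j (\sum_i v 0 i * A i j) * v 0 j.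
Proof.
rewrite /quadratic_form mxE; apply: eq_bigr => j _; rewrite !mxE.
by congr (_ * _).
Qed.

Lemma continuous_quadratic_form (R : realType) m (T : topologicalType)
    (A : T -> 'M[R]_m) (v : T -> 'rV[R]_m) t :
  (forall i j, {for t, continuous (fun s => A s i j)}) ->
  {for t, continuous v} ->
  {for t, continuous (fun s => quadratic_form (A s) (v s))}.
Proof.
move=> cA cv; rewrite (_ : (fun s => _) = fun s =>
    \sum_j (\sum_i v s 0 i * A s i j) * v s 0 j); last first.
  by apply/funext => s; rewrite quadratic_formE.
have cvi i : {for t, continuous (fun s => v s 0 i)}.
  exact: (continuous_comp cv (@coord_continuous R 1 m 0 i (v t))).
have cD : continuous (fun z : R * R => z.1 + z.2) by exact: add_continuous.
apply: (cvg_big cD) => j _; apply: cvgM; last exact: cvi.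
by apply: (cvg_big cD) => i _; apply: cvgM; [exact: cvi|exact: cA].
Qed.

Section curves.
Variables (R : realType) (M : topologicalType) (m : nat).
Variables (S : smooth_manifold R M m) (g : riemannian_metric S).
Implicit Types (k : chart R M m) (e : R -> M) (t : R).

Lemma smooth_in_chart_continuous k (U : set R^o) e t :
  U t -> (forall s, U s -> chart_dom k (e s)) ->
  smooth_on U (chart_map k \o e : R^o -> 'rV[R]_m) -> {for t, continuous e}.
Proof.
move=> Ut Ue sm; have [oU _] := sm.
have cke : {for t, continuous (chart_map k \o e : R^o -> 'rV[R]_m)}.
  exact/differentiable_continuous/(smooth_on_differentiable sm).
have kin : (chart_map k @` chart_dom k) ((chart_map k \o e) t).
  by exists (e t) => //; exact: Ue.
apply: near_eq_continuous_at (continuous_comp cke (chart_inv_continuous_at kin)).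
have : nbhs (t : R^o) U by apply: open_nbhs_nbhs.
by apply: filterS => s Us /=; rewrite chart_mapK//; exact: Ue.
Qed.

Lemma smooth_curve_continuous e t : smooth_curve_at S e t ->
  {for t, continuous e}.
Proof. by move=> [k [U [_ Ut Ue]]]; exact: smooth_in_chart_continuous. Qed.

(** The tensor rule for the components of the metric compensates the chain rule
    for the transition map, so the squared speed can be computed in any chart. *)
Lemma velocity_change k k' (U : set R^o) e t :
  atlas S k -> U t -> (forall s, U s -> chart_dom k (e s)) ->
  smooth_on U (chart_map k \o e : R^o -> 'rV[R]_m) ->
  atlas S k' -> chart_dom k' (e t) ->
  derivable (chart_map k' \o e) t 1 /\
  quadratic_form (g k' (e t)) (derive1 (chart_map k' \o e) t) =
  quadratic_form (g k (e t)) (derive1 (chart_map k \o e) t).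
Proof.
move=> ak Ut Ue sm ak' k'et; have [oU _] := sm.
have ket := Ue t Ut.
have ce := smooth_in_chart_continuous Ut Ue sm.
have dk : differentiable (chart_map k \o e : R^o -> 'rV[R]_m) t.
  exact: smooth_on_differentiable sm Ut.
have dT : differentiable (transition k k') (chart_map k (e t)).
  by apply: (smooth_on_differentiable (atlas_compatible ak ak')); exists (e t).
have nearE : {near t, transition k k' \o (chart_map k \o e) =1 chart_map k' \o e}.
  have : nbhs (t : R^o) U by apply: open_nbhs_nbhs.
  by apply: filterS => s Us /=; rewrite /transition /= chart_mapK//; exact: Ue.
have dc : differentiable (transition k k' \o (chart_map k \o e) : R^o -> 'rV[R]_m) t.
  exact: differentiable_comp.
split; first by apply: (near_eq_derivable nearE); exact: diff_derivable.
have vE : derive1 (chart_map k' \o e) t =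
    derive1 (chart_map k \o e) t *m jacobian (transition k k') (chart_map k (e t)).
  rewrite !derive1E -(near_eq_derive _ nearE) -deriveEjacobian//.
  by rewrite [LHS]deriveE// diff_comp// [RHS]deriveE//= deriveE.
rewrite /quadratic_form vE (metric_change g ak ak' ket k'et).
by rewrite trmx_mul !mulmxA.
Qed.

(** The definition of [speed] uses a chart that may jump from one time to the next;
    this replaces it by a fixed chart. *)
Lemma speed_in_chart k e t : smooth_curve_at S e t -> atlas S k ->
  chart_dom k (e t) ->
  derivable (chart_map k \o e) t 1 /\
  speed g e t = Num.sqrt (quadratic_form (g k (e t)) (derive1 (chart_map k \o e) t)).
Proof.
move=> [k0 [U [ak0 Ut Ue sm]]] ak ket.
have [dk kE] := velocity_change ak0 Ut Ue sm ak ket.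
split; first exact: dk.
rewrite kE /speed.
have [ac cp] := projT2 (cid (atlas_cover S (e t))).
by rewrite -(velocity_change ak0 Ut Ue sm ac cp).2.
Qed.

Lemma speed_continuous e t : smooth_curve_at S e t ->
  {for t, continuous (speed g e)}.
Proof.
move=> et; have [k [U [ak Ut Ue sm]]] := et; have [oU _] := sm.
have nU : nbhs (t : R^o) U by apply: open_nbhs_nbhs.
have nearE : {near t, (fun s => Num.sqrt (quadratic_form (g k (e s))
    ('d (chart_map k \o e : R^o -> 'rV[R]_m) s 1))) =1 speed g e}.
  apply: filterS nU => s Us.
  have es : smooth_curve_at S e s by exists k, U.
  rewrite (speed_in_chart es ak (Ue s Us)).2 derive1E'//.
  exact: smooth_on_differentiable sm Us.
have cs : {for t, continuous (fun s => Num.sqrt (quadratic_form (g k (e s))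
    ('d (chart_map k \o e : R^o -> 'rV[R]_m) s 1)))}.
  apply: (@continuous_comp _ _ _ (fun s => quadratic_form _ _) Num.sqrt).
    apply: continuous_quadratic_form => [i j|].
      have kin : (chart_map k @` chart_dom k) (chart_map k (e t)).
        by exists (e t) => //; exact: Ue.
      have cg : {for chart_map k (e t), continuous (fun u => g k (chart_inv k u) i j : R^o)}.
        apply/differentiable_continuous.
        exact: (smooth_on_differentiable (metric_smooth g ak i j)).
      have ck : {for t, continuous (chart_map k \o e : R -> 'rV[R]_m)}.
        exact/differentiable_continuous/(smooth_on_differentiable sm).
      apply: near_eq_continuous_at (continuous_comp ck cg).
      apply: filterS nU => s Us /=.
      by rewrite chart_mapK//; exact: Ue.
    exact: (smooth_on_continuous_diff sm Ut).
  exact: sqrt_continuous.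
exact: near_eq_continuous_at nearE cs.
Qed.

End curves.

(** * Increments and integrals on intervals *)

(** Supremum argument: the set of $x$ such that [Q a x] holds cannot stop before
    [b], since the local hypothesis at its supremum carries it further. *)
Lemma interval_additive_induction (R : realType) (Q : R -> R -> Prop) (a b : R) :
  a <= b ->
  (forall p q r, a <= p -> p <= q -> q <= r -> r <= b -> Q p q -> Q q r -> Q p r) ->
  (forall t, a <= t <= b -> exists2 delta, 0 < delta & forall p q,
     a <= p -> p <= t -> t <= q -> q <= b -> q - p < delta -> Q p q) ->
  Q a b.
Proof.
move=> ab Qadd Qloc; pose A := [set x | [/\ a <= x, x <= b & Q a x]].
have Aa : A a.
  have [|del d0 h] := Qloc a; first by rewrite lexx.
  by split => //; apply: h; rewrite ?lexx ?subrr.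
have supA : has_sup A by split; [exists a|exists b => x []].
have as_ : a <= sup A by apply: sup_upper_bound.
have sb : sup A <= b by apply: sup_le_ub; [exists a|move=> x []].
have [|del d0 h] := Qloc (sup A); first by rewrite as_.
have d20 : 0 < del / 2 by rewrite divr_gt0.
have [x [ax xb Qax] sx] := sup_adherent d20 supA.
have xs : x <= sup A by apply: sup_upper_bound.
pose q := Num.min b (sup A + del / 4).
have sq : sup A <= q by rewrite le_min sb; lra.
have qb : q <= b by rewrite ge_min lexx.
have qd : q <= sup A + del / 4 by rewrite ge_min lexx orbT.
have Qaq : Q a q.
  apply: (Qadd a x q) => //; first exact: le_trans sq.
  by apply: h => //; lra.
have Aq : A q by split => //; exact: le_trans sq.
have : q <= sup A by apply: sup_upper_bound.
move: Qaq sq; rewrite /q minEle; case: ifP => // _ _ _; lra.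
Qed.

Section interval_integrals.
Variable R : realType.
Notation mu := (@lebesgue_measure R).
Implicit Types (f : R -> R) (a b x : R).

Lemma integrable_itvcc_oo f a b :
  mu.-integrable `]a, b[ (EFin \o f) -> mu.-integrable `[a, b] (EFin \o f).
Proof.
move=> fi; have mf := measurable_int mu fi.
apply/integrableP; split.
  by apply/emeasurable_fun_itv_bndo_bndcP/emeasurable_fun_itv_obnd_cbndP.
rewrite integral_itv_bndoo; first by have /integrableP[] := fi.
exact: measurableT_comp.
Qed.

Lemma Rintegral_itvcc_oo f a b : mu.-integrable `]a, b[ (EFin \o f) ->
  \int[mu]_(t in `[a, b]) f t = \int[mu]_(t in `]a, b[) f t.
Proof.
by move=> fi; rewrite /Rintegral integral_itv_bndoo//; exact: (measurable_int mu).
Qed.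

(** At the break points of a piecewise smooth curve the derivative carries no information;
    these points are negligible. *)
Lemma eq_itvoo_integral f h a b : mu.-integrable `[a, b] (EFin \o f) ->
  (forall t, t \in `]a, b[ -> h t = f t) ->
  mu.-integrable `[a, b] (EFin \o h) /\
  \int[mu]_(t in `[a, b]) h t = \int[mu]_(t in `[a, b]) f t.
Proof.
move=> fi hf.
have fioo : mu.-integrable `]a, b[ (EFin \o f).
  by apply: integrableS fi => //; exact: subset_itvW.
have hioo : mu.-integrable `]a, b[ (EFin \o h).
  by apply: eq_integrable fioo => // t /set_mem tin /=; rewrite hf.
split; first exact: integrable_itvcc_oo.
rewrite !Rintegral_itvcc_oo//.
by apply: eq_Rintegral => t /set_mem tin; exact: hf.
Qed.

Lemma integrable_itv_cat f a x b : a <= x -> x <= b ->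
  mu.-integrable `[a, x] (EFin \o f) -> mu.-integrable `[x, b] (EFin \o f) ->
  mu.-integrable `[a, b] (EFin \o f).
Proof.
move=> ax xb i1 i2.
have E : `[a, b]%classic = `[a, x] `|` `]x, b] :> set R.
  by rewrite -itv_bndbnd_setU ?bnd_simp.
have i2' : mu.-integrable `]x, b] (EFin \o f).
  by apply: integrableS i2 => //; apply: subset_itvr; rewrite bnd_simp.
apply/integrableP.
have mf : measurable_fun (`[a, x] `|` `]x, b]) (EFin \o f).
  by apply/measurable_funU => //; split; apply: (measurable_int mu).
rewrite E; split => //.
rewrite ge0_integral_setU//.
- by apply: lte_add_pinfty; [have /integrableP[] := i1|have /integrableP[] := i2'].
- exact: measurableT_comp.
- apply/disj_setPS => y [/=]; rewrite 2!in_itv/= => /andP[_ yx] /andP[].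
  by rewrite ltNge yx.
Qed.

Lemma Rintegral_itv_cat f a x b : a <= x -> x <= b ->
  mu.-integrable `[a, b] (EFin \o f) ->
  \int[mu]_(t in `[a, b]) f t =
  \int[mu]_(t in `[a, x]) f t + \int[mu]_(t in `[x, b]) f t.
Proof.
move=> ax xb fi; have := Rintegral_itvB fi (x := x).
rewrite !bnd_simp => /(_ ax xb) /eqP; rewrite subr_eq => /eqP ->.
rewrite addrC Rintegral_itv_obnd_cbnd//.
by apply: integrableS fi => //; apply: subset_itvr; rewrite bnd_simp.
Qed.

Lemma continuous_itv_integrable f a b :
  (forall t, a <= t <= b -> {for t, continuous f}) ->
  mu.-integrable `[a, b] (EFin \o f).
Proof.
move=> cf; apply: continuous_compact_integrable; first exact: segment_compact.
by apply: continuous_in_subspaceT => t; rewrite inE/= in_itv/=; exact: cf.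
Qed.

Lemma Rintegral_itv_ge f a b (r : R) : a <= b ->
  mu.-integrable `[a, b] (EFin \o f) ->
  (forall t, a <= t <= b -> r <= f t) ->
  r * (b - a) <= \int[mu]_(t in `[a, b]) f t.
Proof.
move=> ab fi rf.
have mab : mu `[a, b]%classic = (b - a)%:E.
  by rewrite lebesgue_measure_itv/= lte_fin; case: ltP => // ba;
    rewrite (le_anti (introT andP (conj ab ba))) subrr.
rewrite -[b - a](congr1 fine mab) -Rintegral_cst//.
apply: le_Rintegral => //.
by apply: continuous_itv_integrable => t _; exact: cvg_cst.
Qed.

(** A mean value inequality for functions, such as a truncated distance along a
    curve, that need not be differentiable: increments are compared on short
    intervals around each point, where the integrand is almost constant, and then
    added up. *)
Lemma increment_le_integral (f v : R -> R) a b : a <= b ->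
  (forall t, a <= t <= b -> {for t, continuous v}) ->
  (forall t e, a <= t <= b -> 0 < e ->
    \forall s \near t, `|f s - f t| <= (v t + e) * `|s - t|) ->
  `|f b - f a| <= \int[mu]_(t in `[a, b]) v t.
Proof.
move=> ab cv fv; apply/ler_addgt0Pr => e e0.
pose e' := e / (b - a + 1).
have ba1 : 0 < b - a + 1 by lra.
have e'0 : 0 < e' by rewrite divr_gt0.
have vi p q : a <= p -> q <= b -> mu.-integrable `[p, q] (EFin \o v).
  by move=> ap qb; apply: continuous_itv_integrable => t /andP[pt tq]; apply: cv; lra.
suff : `|f b - f a| <= \int[mu]_(t in `[a, b]) v t + e' * (b - a).
  move=> /le_trans; apply; rewrite lerD2l /e' mulrAC ler_pdivrMr//.
  by rewrite ler_pM2l//; lra.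
pose Q p q := `|f q - f p| <= \int[mu]_(t in `[p, q]) v t + e' * (q - p).
apply: (@interval_additive_induction _ Q) => //.
  move=> p q r ap pq qr rb; rewrite /Q => h1 h2.
  rewrite (@Rintegral_itv_cat v p q r)//; last by apply: vi; lra.
  apply: le_trans (ler_distD (f q) _ _) _.
  by move: h1 h2; lra.
move=> t atb.
have e'2 : 0 < e' / 2 by rewrite divr_gt0.
have /= near1 := fv t _ atb e'2.
have near2 : \forall s \near t, `|v t - v s| < e' / 2.
  by have /cvgrPdist_lt := cv t atb; apply.
have [del /= d0 H] : exists2 del : R, 0 < del & forall s, `|t - s| < del ->
    `|f s - f t| <= (v t + e' / 2) * `|s - t| /\ `|v t - v s| < e' / 2.
  have /nbhs_ballP[del d0 H] : nbhs t [set s |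
      `|f s - f t| <= (v t + e' / 2) * `|s - t| /\ `|v t - v s| < e' / 2].
    exact: filterI near1 near2.
  by exists del => // s ts; exact: H.
exists del => // p q ap pt tq qb qp.
have [fp _] := H p (ltac:(rewrite ger0_norm; lra)).
have [fq _] := H q (ltac:(rewrite ler0_norm; lra)).
have vge : (v t - e' / 2) * (q - p) <= \int[mu]_(s in `[p, q]) v s.
  apply: Rintegral_itv_ge; [lra|exact: vi|move=> s /andP[ps sq]].
  have [|_] := H s; first by rewrite ltr_norml; lra.
  by rewrite ltr_norml => /andP[]; lra.
rewrite /Q.
apply: le_trans (ler_distD (f t) _ _) _.
move: fp fq vge; rewrite [`|f p - _|]distrC [`|p - t|]distrC.
rewrite [`|t - p|]ger0_norm; last lra.
rewrite [`|q - t|]ger0_norm; last lra.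
nra.
Qed.

End interval_integrals.

(** * Quadratic forms *)

Lemma quadratic_formB (R : realType) m (A B : 'M[R]_m) v :
  quadratic_form (A - B) v = quadratic_form A v - quadratic_form B v.
Proof. by rewrite /quadratic_form mulmxBr mulmxBl !mxE. Qed.

Lemma quadratic_formZ (R : realType) m (A : 'M[R]_m) (r : R) v :
  quadratic_form A (r *: v) = r ^+ 2 * quadratic_form A v.
Proof.
by rewrite /quadratic_form linearZ/= -!scalemxAl -scalemxAr !mxE mulrA.
Qed.

Lemma quadratic_form_le (R : realType) m (A : 'M[R]_m) (eps : R) v :
  (forall i j, `|A i j| <= eps) ->
  `|quadratic_form A v| <= m%:R ^+ 2 * eps * `|v| ^+ 2.
Proof.
move=> Ae; rewrite quadratic_formE.
apply: le_trans (ler_norm_sum _ _ _) _.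
rewrite (_ : _ * _ = \sum_(j < m) m%:R * eps * `|v| ^+ 2); last first.
  by rewrite sumr_const card_ord -[RHS]mulr_natl; ring.
apply: ler_sum => j _; rewrite normrM expr2 mulrA.
apply: ler_pM => //; last exact: rV_coord_le.
apply: le_trans (ler_norm_sum _ _ _) _.
rewrite (_ : _ * _ = \sum_(i < m) `|v| * eps); last first.
  by rewrite sumr_const card_ord -[RHS]mulr_natl; ring.
by apply: ler_sum => i _; rewrite normrM ler_pM// rV_coord_le.
Qed.

Lemma rV_closed_ball_compact (R : realType) m (u : 'rV[R]_m) (r : R) :
  0 <= r -> compact [set v | `|v - u| <= r].
Proof.
move=> r0.
have -> : [set v : 'rV[R]_m | `|v - u| <= r] =
    [set v | forall i, `[u 0 i - r, u 0 i + r]%classic (v 0 i)].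
  apply/seteqP; split => v /=.
    move=> /(rV_norm_leP _ r0) h i; have := h i.
    by rewrite !mxE in_itv/= ler_norml; lra.
  move=> h; apply/rV_norm_leP => // i; have := h i.
  by rewrite !mxE in_itv/= ler_norml; lra.
by apply: (@rV_compact _ _ (fun i => `[u 0 i - r, u 0 i + r]%classic)) => i;
  exact: segment_compact.
Qed.

(** The minimum on the compact unit sphere is positive; the sphere is empty in
    dimension zero, where every constant works. *)
Lemma posdef_quadratic_form_ge (R : realType) m (A : 'M[R]_m) :
  (forall v : 'rV[R]_m, v != 0 -> 0 < quadratic_form A v) ->
  exists2 lambda : R, 0 < lambda &
    forall v, lambda * `|v| ^+ 2 <= quadratic_form A v.
Proof.
move=> Apos; pose sph := [set v : 'rV[R]_m | `|v| = 1].
have Q0 : quadratic_form A 0 = 0 by rewrite /quadratic_form !mul0mx mxE.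
have cQ : continuous (quadratic_form A).
  move=> v; apply: (@continuous_quadratic_form _ _ _ (fun=> A) id v).
    by move=> i j; apply: cst_continuous.
  exact: cvg_id.
have csph : compact sph.
  have cl : closed sph.
    apply: (@preimage_closed _ _ (fun v : 'rV[R]_m => `|v|) [set 1]).
      by move=> v _; exact: norm_continuous.
    exact: (@closed_eq R 1).
  apply: subclosed_compact cl (@rV_closed_ball_compact _ _ 0 1 _) _ => //.
  by move=> v /= ; rewrite subr0 => ->.
have [[v0 sv0]|nsph] := pselect (sph !=set0); last first.
  exists 1 => // v; have [->|v0] := eqVneq v 0.
    by rewrite Q0 normr0 expr0n mulr0.
  exfalso; apply: nsph; exists (`|v|^-1 *: v).
  by rewrite /sph/= normrZ normfV normr_id mulVf// normr_eq0.
have [c /set_mem cs cmin] := @EVT_min_rV R m (quadratic_form A) sph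
  (ex_intro _ v0 sv0) csph (continuous_subspaceT cQ).
exists (quadratic_form A c).
  by apply: Apos; apply: contraPneq cs => ->; rewrite /sph/= normr0 => /eqP;
    rewrite eq_sym oner_eq0.
move=> v; have [->|v0'] := eqVneq v 0; first by rewrite Q0 normr0 expr0n mulr0.
have nv : 0 < `|v| by rewrite normr_gt0.
have sv : `|v|^-1 *: v \in sph.
  by apply/mem_set; rewrite /sph/= normrZ normfV normr_id mulVf// gt_eqF.
have := cmin _ sv; rewrite quadratic_formZ exprVn mulrC.
by rewrite ler_pdivlMr// exprn_gt0.
Qed.

(** * Bounds on the metric in a chart *)

Lemma derivable_increment_le (R : realType) (V : normedModType R) (h : R -> V)
    (t e : R) : derivable h t 1 -> 0 < e ->
  \forall s \near t, `|h s - h t| <= (`|derive1 h t| + e) * `|s - t|.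
Proof.
move=> dh e0; rewrite derive1E.
have /cvgrPdist_lt/(_ _ e0) := dh.
rewrite near_withinE => /nbhs_ballP[d /= d0 dP].
apply/nbhs_ballP; exists d => // s; rewrite /ball/= => ts.
have [->|st] := eqVneq s t; first by rewrite !subrr !normr0 mulr0.
have st0 : s - t != 0 by rewrite subr_eq0.
have := dP (s - t); rewrite /ball/= sub0r normrN distrC => /(_ ts st0).
rewrite -/('D_1 h t) [(s - t)%:A]mulr1 subrK => lt_e.
have -> : h s - h t = (s - t) *: ((s - t)^-1 *: (h s - h t)).
  by rewrite scalerA mulfV// scale1r.
rewrite normrZ mulrC [`|t - s|]distrC ler_wpM2r//.
move: lt_e; set q := _ *: (h s - h t) => lt_e.
rewrite -[q](subKr ('D_1 h t)).
by apply: le_trans (ler_normB _ _) _; rewrite lerD2l ltW.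
Qed.

Section local_comparison.
Variables (R : realType) (M : topologicalType) (m : nat).
Variables (S : smooth_manifold R M m) (g : riemannian_metric S).
Implicit Types (k : chart R M m) (e : R -> M) (t : R).

Lemma chart_ball k z : chart_dom k z ->
  exists2 r, 0 < r & forall u, `|u - chart_map k z| <= r ->
    (chart_map k @` chart_dom k) u.
Proof.
move=> kz.
have : nbhs (chart_map k z) (chart_map k @` chart_dom k).
  by apply: open_nbhs_nbhs; split; [exact: chart_img_open|exists z].
move=> /nbhs_ballP[r /= r0 rball]; exists (r / 2); first by rewrite divr_gt0.
move=> u ur; apply: rball; rewrite -ball_normE /= distrC.
by apply: le_lt_trans ur _; lra.
Qed.

(** Positive definiteness at the centre gives bounds there, and continuity of the
    components propagates them, up to a factor, to a neighbourhood. *)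
Lemma metric_bounds_near k z : atlas S k -> chart_dom k z ->
  exists r lambda C : R, [/\ 0 < r, 0 < lambda, 0 < C &
    forall u, `|u - chart_map k z| <= r ->
      (chart_map k @` chart_dom k) u /\
      forall v, lambda * `|v| <= Num.sqrt (quadratic_form (g k (chart_inv k u)) v)
                <= C * `|v|].
Proof.
move=> ak kz; have [r1 r10 r1ball] := chart_ball kz.
have [mu mu0 muP] := posdef_quadratic_form_ge (metric_posdef g ak kz).
pose A0 := g k z.
pose E : R := \sum_i \sum_j `|A0 i j|.
have E0 : 0 <= E by do 2 (apply: sumr_ge0 => ? _).
have A0E i j : `|A0 i j| <= E.
  rewrite /E (bigD1 i)//= (bigD1 j)//= -addrA ler_wpDr// addr_ge0//.
    by apply: sumr_ge0.
  by do 2 (apply: sumr_ge0 => ? _).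
pose m2 : R := m%:R ^+ 2.
have m20 : 0 <= m2 by rewrite exprn_ge0.
(* The perturbation of the entries changes the form by at most half of [mu]. *)
pose eps := mu / (2 * (m2 + 1)).
have eps0 : 0 < eps by rewrite divr_gt0// mulr_gt0//; lra.
have m2eps : m2 * eps <= mu / 2.
  rewrite /eps mulrA ler_pdivrMr; last by rewrite mulr_gt0//; lra.
  nra.
have kin : (chart_map k @` chart_dom k) (chart_map k z) by exists z.
have near_entries : \forall u \near chart_map k z,
    forall ij : 'I_m * 'I_m, `|(g k (chart_inv k u) - A0) ij.1 ij.2| < eps.
  apply: (@filter_forall _ ('I_m * 'I_m)%type
    (fun ij u => `|(g k (chart_inv k u) - A0) ij.1 ij.2| < eps) (nbhs _) _) => -[i j] /=.
  have /differentiable_continuous := smooth_on_differentiable (metric_smooth g ak i j) kin.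
  move=> /cvgrPdist_lt/(_ _ eps0); apply: filterS => u.
  by rewrite chart_mapK// !mxE distrC.
have /nbhs_ballP[r2 /= r20 r2ball] := near_entries.
pose r := Num.min r1 (r2 / 2).
exists r, (Num.sqrt (mu / 2)), (Num.sqrt (mu / 2 + m2 * E)).
have h1 : 0 < mu / 2 by rewrite divr_gt0.
have h2 : 0 < mu / 2 + m2 * E by rewrite ltr_pwDl// mulr_ge0.
split; [by rewrite lt_min r10 divr_gt0|by rewrite sqrtr_gt0|by rewrite sqrtr_gt0|].
move=> u; rewrite le_min => /andP[ur1 ur2]; split; first exact: r1ball.
move=> v; set A := g k _.
have AA0 i j : `|(A - A0) i j| <= eps.
  apply/ltW/(r2ball u _ (i, j)); rewrite -ball_normE/= distrC.
  by apply: le_lt_trans ur2 _; lra.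
have := quadratic_form_le v AA0; have := quadratic_form_le v A0E; have := muP v.
rewrite quadratic_formB -/m2 -/A0 !ler_norml => q1 /andP[_ q2] /andP[q3 q4].
have v0 : 0 <= `|v| ^+ 2 by rewrite exprn_ge0.
have sq (c : R) : 0 < c -> Num.sqrt c * `|v| = Num.sqrt (c * `|v| ^+ 2).
  by move=> c0; rewrite sqrtrM ?ltW// sqrtr_sqr ger0_norm.
have m2ev : m2 * eps * `|v| ^+ 2 <= mu / 2 * `|v| ^+ 2 by rewrite ler_wpM2r.
by rewrite !sq// !ler_wsqrtr// ?mulrDl; lra.
Qed.

End local_comparison.

(** * Lengths of curves from below *)

(** The distance to the point with coordinates [u0], truncated at [s]: being
    constant off the chart ball of radius [s], it is defined on the whole
    manifold, so that curves which leave the chart are not a special case. *)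
Definition truncated_coord_dist (R : realType) (M : topologicalType) m
    (k : chart R M m) (u0 : 'rV[R]_m) (s : R) (p : M) : R :=
  if `[< chart_dom k p /\ `|chart_map k p - u0| <= s >]
  then `|chart_map k p - u0| else s.

Lemma truncated_coord_distE (R : realType) (M : topologicalType) m
    (k : chart R M m) u0 (s : R) p : chart_dom k p ->
  truncated_coord_dist k u0 s p = Num.min `|chart_map k p - u0| s.
Proof.
move=> kp; rewrite /truncated_coord_dist minEle.
by case: asboolP => [[_ ->]//|]; case: ifP => // le_s [].
Qed.

Lemma min_dist_le (R : realType) (a b s : R) :
  `|Num.min a s - Num.min b s| <= `|a - b|.
Proof.
rewrite !minEle; case: (leP a s) => as_; case: (leP b s) => bs //.
- rewrite [leRHS]ler0_norm; last lra.
  by rewrite ler0_norm; lra.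
- rewrite [leRHS]ger0_norm; last lra.
  by rewrite ger0_norm; lra.
- by rewrite subrr normr0.
Qed.

Section lower_bound.
Variables (R : realType) (M : topologicalType) (m : nat).
Variables (S : smooth_manifold R M m) (g : riemannian_metric S).
Notation mu := (@lebesgue_measure R).

Lemma speed_ge0 (c : R -> M) t : 0 <= speed g c t.
Proof. exact: sqrtr_ge0. Qed.

(** Inside the closed chart ball the truncated distance is a contraction of the
    coordinates, whose velocity is controlled by the speed. Outside it the truncated
    distance is locally constant, because the ball is compact, hence closed, in a
    Hausdorff space. *)
Lemma truncated_dist_le_length k u0 (s lambda : R) :
  atlas S k -> 0 <= s -> 0 < lambda ->
  (forall u, `|u - u0| <= s -> (chart_map k @` chart_dom k) u /\
     forall v, lambda * `|v| <= Num.sqrt (quadratic_form (g k (chart_inv k u)) v)) ->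
  forall (e : R -> M) t0 t1, t0 <= t1 ->
  (forall t, t0 <= t <= t1 -> smooth_curve_at S e t) ->
  `|lambda * truncated_coord_dist k u0 s (e t1) -
    lambda * truncated_coord_dist k u0 s (e t0)| <=
  \int[mu]_(t in `[t0, t1]) speed g e t.
Proof.
move=> ak s0 l0 ball_k e t0 t1 t01 sme.
set D := truncated_coord_dist k u0 s.
apply: (@increment_le_integral _ (fun t => lambda * D (e t))) => //.
  by move=> t /sme; exact: speed_continuous.
move=> t eps tin eps0; have smt := sme t tin.
have ce := smooth_curve_continuous smt.
pose K := chart_inv k @` [set u | `|u - u0| <= s].
have Kclosed : closed K.
  apply: compact_closed; first exact: manifold_hausdorff S.
  apply: continuous_compact; last exact: rV_closed_ball_compact.
  apply: continuous_subspaceW (@chart_inv_continuous _ _ _ k) => u us.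
  by have [] := ball_k u us.
have KP p : K p <-> chart_dom k p /\ `|chart_map k p - u0| <= s.
  split=> [[u us <-]|[kp ps]].
    by have [/chart_img_inv[? ->]] := ball_k u us.
  by exists (chart_map k p) => //; exact: chart_mapK.
have [Kt|nKt] := pselect (K (e t)); last first.
  have nK : \forall x \near t, ~ K (e x).
    apply: (ce (~` K)); apply: open_nbhs_nbhs; split => //.
    exact: closed_openC.
  have DK p : ~ K p -> D p = s.
    by move=> nKp; rewrite /D /truncated_coord_dist asboolF// -KP.
  apply: filterS nK => x nKx; rewrite !DK// subrr normr0.
  by rewrite mulr_ge0// addr_ge0 ?speed_ge0// ltW.
have [kt ts] := (KP _).1 Kt.
have [dkt spE] := speed_in_chart g smt ak kt.
have nd : \forall x \near t, chart_dom k (e x).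
  by apply: (ce (chart_dom k)); exact: chart_dom_nbhs.
have el0 : 0 < eps / lambda by rewrite divr_gt0.
have speed_ge : lambda * `|derive1 (chart_map k \o e) t| <= speed g e t.
  by rewrite spE; have [_ h] := ball_k _ ts; have := h (derive1 (chart_map k \o e) t);
    rewrite (chart_mapK kt); apply.
have ninc := derivable_increment_le dkt el0.
move: (derive1 _ t) speed_ge ninc => w speed_ge ninc.
apply: filterS2 nd ninc => x kx incx.
have Dx : `|D (e x) - D (e t)| <= (`|w| + eps / lambda) * `|x - t|.
  rewrite /D (truncated_coord_distE u0 s kx) (truncated_coord_distE u0 s kt).
  apply: le_trans (min_dist_le _ _ _) _.
  apply: le_trans (ler_dist_dist _ _) _.
  by rewrite opprB addrA subrK.
rewrite -mulrBr normrM [X in X * _](gtr0_norm l0).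
apply: le_trans (ler_wpM2l (ltW l0) Dx) _.
have -> : lambda * ((`|w| + eps / lambda) * `|x - t|) =
    (lambda * `|w| + eps) * `|x - t|.
  by field; exact: lt0r_neq0.
exact: (ler_wpM2r (normr_ge0 _) (lerD speed_ge (lexx _))).
Qed.

Lemma speed_eq_near (c e : R -> M) t : {near t, c =1 e} ->
  speed g c t = speed g e t.
Proof.
move=> ce; rewrite /speed (nbhs_singleton ce).
set k := chart_at S (e t).
have -> // : derive1 (chart_map k \o c) t = derive1 (chart_map k \o e) t.
rewrite !derive1E; apply: near_eq_derive.
by apply: filterS ce => s /= ->.
Qed.

Lemma smooth_piece_length (c e : R -> M) t0 t1 :
  {in `[t0, t1], forall t, smooth_curve_at S e t} ->
  {in `[t0, t1], forall t, c t = e t} ->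
  mu.-integrable `[t0, t1] (EFin \o speed g c) /\
  \int[mu]_(t in `[t0, t1]) speed g c t = \int[mu]_(t in `[t0, t1]) speed g e t.
Proof.
move=> sme ce.
have ie : mu.-integrable `[t0, t1] (EFin \o speed g e).
  apply: continuous_itv_integrable => t tin.
  by apply: speed_continuous; apply: sme; rewrite in_itv.
apply: (eq_itvoo_integral ie) => t tin.
apply: speed_eq_near.
have : nbhs t `]t0, t1[%classic.
  by apply: open_nbhs_nbhs; split => //; exact: interval_open.
by apply: filterS => s sin; apply: ce; apply: subset_itvW sin.
Qed.

(** Increments of $F$ and lengths are both additive over the smooth pieces.
    Integrability of the speed is part of the conclusion because a real-valued
    integral is zero when the underlying extended one is infinite. *)
Lemma curve_segment_length_ge (F : M -> R) :
  (forall (e : R -> M) t0 t1, t0 <= t1 ->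
     (forall t, t0 <= t <= t1 -> smooth_curve_at S e t) ->
     `|F (e t1) - F (e t0)| <= \int[mu]_(t in `[t0, t1]) speed g e t) ->
  forall a b c, curve_segment S a b c ->
  mu.-integrable `[a, b] (EFin \o speed g c) /\
  `|F (c b) - F (c a)| <= curve_length g a b c.
Proof.
move=> HF a b c [_ [s sab pieces]]; rewrite /curve_length.
elim: s a sab pieces => [a /itv_partition_nil -> _|x s IH a sab pieces].
  rewrite subrr normr0 set_itv1; split; last by rewrite Rintegral_set1.
  rewrite -set_itv1; apply: integrable_itvcc_oo.
  rewrite set_itv_ge; first exact: integrable_set0.
  by rewrite bnd_simp ltxx.
have xsb := itv_partition_cons sab.
have ax : a < x by case: sab => /= /andP[].
have xb : x <= b := itv_partition_le xsb.
have [|ixb Fxb] := IH x xsb.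
  by move=> i ilt; have := pieces i.+1 ilt.
have [e sme ce] := pieces 0%N isT; rewrite /= in sme ce.
have [iax lax] := smooth_piece_length sme ce.
have iab : mu.-integrable `[a, b] (EFin \o speed g c).
  exact: integrable_itv_cat (ltW ax) xb iax ixb.
split; first exact: iab.
rewrite (Rintegral_itv_cat (ltW ax) xb iab) lax.
apply: le_trans (ler_distD (F (c x)) _ _) _.
have Fax : `|F (c x) - F (c a)| <= \int[mu]_(t in `[a, x]) speed g e t.
  have -> : c x = e x by apply: ce; rewrite in_itv/= lexx ltW.
  have -> : c a = e a by apply: ce; rewrite in_itv/= lexx ltW.
  by apply: (HF _ _ _ (ltW ax)) => t tin; apply: sme; rewrite in_itv.
by rewrite addrC; exact: (lerD Fax Fxb).
Qed.

End lower_bound.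

(** * Comparison of the Riemannian distance with coordinates *)

Section local_distance.
Variables (R : realType) (m : nat).

Lemma is_diff_affine (a w : 'rV[R]_m) (t : R^o) :
  is_diff t (fun s : R^o => a + s *: w) (fun s : R^o => s *: w).
Proof.
have h1 : is_diff t (cst a : R^o -> 'rV[R]_m) 0 by exact: is_diff_cst.
have h2 : is_diff t (fun s : R^o => s *: w) (fun s : R^o => s *: w).
  exact: is_diff_scalel.
have := is_diffD h1 h2; congr (is_diff_def _ _ _).
by rewrite add0r.
Qed.

Lemma affine_near_diff (U : set R^o) (c : R^o -> 'rV[R]_m) a w t :
  open U -> (forall s, U s -> c s = a + s *: w) -> U t ->
  differentiable c t /\ forall v, 'd c t v = v *: w.
Proof.
move=> oU cE Ut.
have nE : {near t, (fun s : R^o => a + s *: w) =1 c}.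
  have : nbhs t U by apply: open_nbhs_nbhs.
  by apply: filterS => s Us; rewrite cE.
have [da dE] := is_diff_affine a w t.
have dc : differentiable c t.
  by apply/derivable1_diffP; apply: (near_eq_derivable nE); exact/derivable1_diffP.
split => // v.
by rewrite -deriveE// -(near_eq_derive _ nE) deriveE// dE.
Qed.

(** Differentiating an affine map gives a constant one, which is affine again. *)
Lemma affine_smooth_on (U : set R^o) (c : R^o -> 'rV[R]_m) a w :
  open U -> (forall s, U s -> c s = a + s *: w) -> smooth_on U c.
Proof.
move=> oU cE; split => // n.
elim: n c a w cE => [c a w cE|n IH c a w cE] /=.
  rewrite continuous_open_subspace// => t /set_mem Ut.
  by apply: differentiable_continuous; exact: (affine_near_diff oU cE Ut).1.
split => [t Ut|v]; first exact: (affine_near_diff oU cE Ut).1.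
apply: (IH _ (v *: w) 0) => t Ut.
by rewrite scaler0 addr0; exact: (affine_near_diff oU cE Ut).2.
Qed.

Variables (M : topologicalType) (S : smooth_manifold R M m).
Variable g : riemannian_metric S.
Notation mu := (@lebesgue_measure R).

Lemma riemannian_dist_le_length a b (c : R -> M) : curve_segment S a b c ->
  riemannian_dist g (c a) (c b) <= curve_length g a b c.
Proof.
move=> cs; apply: ge_inf.
  exists 0 => _ [a' [b' [c' [_ _ _ ->]]]].
  by apply: Rintegral_ge0 => t _; exact: speed_ge0.
by exists a, b, c.
Qed.

Section line.
Variables (k : chart R M m) (u0 : 'rV[R]_m) (r : R).
Hypothesis ak : atlas S k.
Hypothesis ball_img :
  forall u, `|u - u0| <= r -> (chart_map k @` chart_dom k) u.

Let line (u v : 'rV[R]_m) (t : R) := chart_inv k (u + t *: (v - u)).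

Let line_ball (u v : 'rV[R]_m) (t : R) : `|u - u0| <= r -> `|v - u0| <= r ->
  0 <= t <= 1 -> `|u + t *: (v - u) - u0| <= r.
Proof.
move=> ur vr /andP[t0 t1].
have -> : u + t *: (v - u) - u0 = (1 - t) *: (u - u0) + t *: (v - u0).
  by apply/rowP => i; rewrite !mxE; ring.
apply: le_trans (ler_normD _ _) _; rewrite !normrZ !ger0_norm ?subr_ge0//.
nra.
Qed.

Let line_dom (u v : 'rV[R]_m) := [set t : R^o |
  (chart_map k @` chart_dom k) (u + t *: (v - u))].

Let line_dom_open u v : open (line_dom u v).
Proof.
have co : continuous (fun t : R^o => u + t *: (v - u)).
  move=> t; apply: differentiable_continuous.
  by have [] := is_diff_affine u (v - u) t.
by have /continuousP := co; apply; exact: chart_img_open.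
Qed.

Let lineE u v t : line_dom u v t -> (chart_map k \o line u v) t = u + t *: (v - u).
Proof. by move=> /chart_img_inv[_ /= ->]. Qed.

Let line_smooth u v t : line_dom u v t -> smooth_curve_at S (line u v) t.
Proof.
move=> dt; exists k, (line_dom u v); split => //.
  by move=> s /chart_img_inv[].
exact: (@affine_smooth_on (line_dom u v) _ u (v - u) (@line_dom_open u v) (@lineE u v)).
Qed.

Let line_in_dom u v t : `|u - u0| <= r -> `|v - u0| <= r -> 0 <= t <= 1 ->
  line_dom u v t.
Proof. by move=> ur vr t01; apply: ball_img; exact: line_ball. Qed.

Let line_segment u v : `|u - u0| <= r -> `|v - u0| <= r ->
  curve_segment S 0 1 (line u v).
Proof.
move=> ur vr; split => //; exists [:: 1]; first exact: itv_partition1.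
move=> [|//] _; exists (line u v) => // t; rewrite in_itv/= => t01.
by apply: line_smooth; exact: line_in_dom.
Qed.

Let line_ends u v : line u v 0 = chart_inv k u /\ line u v 1 = chart_inv k v.
Proof. by rewrite /line scale0r addr0 scale1r addrC subrK. Qed.

(** The coordinate segment is a competitor. *)
Lemma riemannian_dist_le_coord (C : R) :
  (forall u, `|u - u0| <= r -> forall v,
     Num.sqrt (quadratic_form (g k (chart_inv k u)) v) <= C * `|v|) ->
  forall u v, `|u - u0| <= r -> `|v - u0| <= r ->
  riemannian_dist g (chart_inv k u) (chart_inv k v) <= C * `|u - v|.
Proof.
move=> HC u v ur vr.
have seg := line_segment ur vr; have [<- <-] := line_ends u v.
apply: le_trans (riemannian_dist_le_length seg) _.
have [|ispeed _] := @curve_segment_length_ge _ _ _ _ g (fun=> 0) _ _ _ _ seg.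
  move=> e t0 t1 t01 _; rewrite subrr normr0.
  by apply: Rintegral_ge0 => t _; exact: speed_ge0.
have muI : fine (mu `[0, 1]%classic) = 1.
  by rewrite lebesgue_measure_itv/= lte_fin ltr01 oppr0 adde0.
rewrite -[leRHS]mulr1 -[X in _ * X]muI -Rintegral_cst//.
apply: le_Rintegral => //.
  by apply: continuous_itv_integrable => t _; exact: cvg_cst.
move=> t /=; rewrite in_itv/= => t01.
have dt := line_in_dom ur vr t01.
have [kt _] := chart_img_inv dt.
have [_ spE] := speed_in_chart g (line_smooth dt) ak kt.
have [dk dE] := affine_near_diff (@line_dom_open u v) (@lineE u v) dt.
rewrite spE derive1E'; last exact: dk.
rewrite dE scale1r distrC.
by apply: HC; exact: line_ball.
Qed.

(** The truncated distance from the first point is zero at the first point and equal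
    to the coordinate distance at the second. The radius is divided by three so
    that the ball of radius $2r/3$ around the first point contains the second one
    and is contained in the ball where the metric is bounded below. *)
Lemma riemannian_dist_ge_coord (lambda : R) : 0 < lambda -> 0 <= r ->
  (forall u, `|u - u0| <= r -> forall v,
     lambda * `|v| <= Num.sqrt (quadratic_form (g k (chart_inv k u)) v)) ->
  forall u v, `|u - u0| <= r / 3 -> `|v - u0| <= r / 3 ->
  lambda * `|u - v| <= riemannian_dist g (chart_inv k u) (chart_inv k v).
Proof.
move=> l0 r0 Hl u v ur vr.
have ur' : `|u - u0| <= r by apply: le_trans ur _; lra.
have vr' : `|v - u0| <= r by apply: le_trans vr _; lra.
have uv : `|v - u| <= r * 2 / 3.
  have -> : v - u = (v - u0) - (u - u0) by rewrite opprB addrA subrK.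
  by apply: le_trans (ler_normB _ _) _; lra.
apply: lb_le_inf.
  have [e0 e1] := line_ends u v.
  (* The infimum of the empty set is zero: the coordinate segment shows that there
     is a curve. *)
  by exists (curve_length g 0 1 (line u v)), 0, 1, (line u v); split => //;
    exact: line_segment.
move=> _ [a [b [c [seg ca cb ->]]]].
pose s := r * 2 / 3.
have s0 : 0 <= s by rewrite /s; lra.
have [|_] := @curve_segment_length_ge _ _ _ _ g
    (fun p => lambda * truncated_coord_dist k u s p) _ _ _ _ seg.
  apply: truncated_dist_le_length => // x xu.
  have xr : `|x - u0| <= r.
    rewrite -(subrK u x) -addrA; apply: le_trans (ler_normD _ _) _.
    by move: xu ur; rewrite /s; lra.
  by split; [exact: ball_img|exact: Hl].
have [ku kuE] := chart_img_inv (ball_img ur').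
have [kv kvE] := chart_img_inv (ball_img vr').
rewrite ca cb !truncated_coord_distE// kuE kvE subrr normr0.
rewrite (min_l s0) (min_l uv) mulr0 subr0 distrC.
by rewrite ger0_norm// mulr_ge0// ltW.
Qed.

End line.

(** Every point has a chart that is bi-Lipschitz for the Riemannian distance. The
    upper bound transfers the hypothesis on increments to coordinates; the lower
    bound transfers uniform continuity back. *)
Lemma riemannian_dist_coord (z : M) : exists (k : chart R M m) (r lambda C : R),
  [/\ atlas S k, chart_dom k z, 0 < r, 0 < lambda & 0 < C] /\
  forall u v, `|u - chart_map k z| <= r -> `|v - chart_map k z| <= r ->
    (chart_map k @` chart_dom k) u /\
    lambda * `|u - v| <= riemannian_dist g (chart_inv k u) (chart_inv k v)
                      <= C * `|u - v|.
Proof.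
have [k [ak kz]] := atlas_cover S z.
have [r [lambda [C [r0 l0 C0 H]]]] := metric_bounds_near g ak kz.
have sub u : `|u - chart_map k z| <= r / 3 -> `|u - chart_map k z| <= r.
  by move=> ur; apply: le_trans ur _; lra.
exists k, (r / 3), lambda, C; split; first by split => //; rewrite divr_gt0.
move=> u v ur vr; split; first exact: (H u (sub u ur)).1.
apply/andP; split.
  apply: (@riemannian_dist_ge_coord k (chart_map k z) r) => //.
  - by move=> x /H[].
  - exact: ltW.
  - by move=> x /H[_ h] y; have /andP[] := h y.
apply: (@riemannian_dist_le_coord k (chart_map k z) r) => //.
- by move=> x /H[].
- by move=> x /H[_ h] y; have /andP[] := h y.
- exact: sub.
- exact: sub.
Qed.

End local_distance.

(** * The local modification in a chart *)

Lemma log2_inv_ge (R : realType) n (h : R) : 0 < h -> h <= 2 ^- n ->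
  n%:R <= log2 h^-1.
Proof.
move=> h0 hn; rewrite /log2 ler_pdivlMr ?ln_gt0 ?ltr1n// mulr_natl -lnXn//.
by rewrite ler_ln ?posrE ?invr_gt0 ?exprn_gt0// -[leLHS]invrK lef_pV2 ?posrE
  ?invr_gt0 ?exprn_gt0.
Qed.

Lemma powRN_le (R : realType) (a x y : R) : 0 <= a -> 0 < x -> x <= y ->
  y `^ (- a) <= x `^ (- a).
Proof.
move=> a0 x0 xy; have y0 := lt_le_trans x0 xy.
rewrite !powRN lef_pV2 ?posrE ?powR_gt0//.
by apply: ge0_ler_powR; rewrite ?nnegrE ?(ltW x0) ?(ltW y0).
Qed.

(** Both functions are increasing; on dyadic arguments they are powers of the
    level, which are summable for exponents larger than one. *)
Lemma r_fun_le (R : realType) (beta h : R) n : 0 <= beta -> 0 <= h ->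
  h <= 2 ^- n.+1 -> r_fun beta h <= n.+1%:R `^ (- beta).
Proof.
move=> b0; rewrite /r_fun le_eqVlt eq_sym.
case: eqVneq => [_ _ _|_ /= h0 hn]; first exact: powR_ge0.
by apply: powRN_le => //; exact: log2_inv_ge.
Qed.

Lemma q_fun_le (R : realType) (K alpha h : R) m n : 0 <= K -> 0 <= alpha ->
  0 <= h -> h <= 2 ^- n.+1 ->
  q_fun K alpha m h <= K * n.+1%:R `^ (- alpha) / 2 ^+ (n * m).
Proof.
move=> K0 a0 h0 hn; rewrite /q_fun; case: eqVneq => [_|hneq].
  by rewrite divr_ge0 ?exprn_ge0// mulr_ge0 ?powR_ge0.
have h0' : 0 < h by rewrite lt_neqAle eq_sym hneq.
apply: ler_pM; rewrite ?exprn_ge0 ?mulr_ge0 ?powR_ge0//.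
  by rewrite ler_wpM2l//; apply: powRN_le => //; exact: log2_inv_ge.
rewrite exprM -exprVn; apply: lerXn2r; rewrite ?nnegrE ?invr_ge0 ?exprn_ge0//.
apply: le_trans hn _; rewrite lef_pV2 ?posrE ?exprn_gt0//.
by rewrite ler_weXn2l ?ler1n.
Qed.

Section local_modification.
Variables (R : realType) (m : nat) (M : topologicalType).
Variables (S : smooth_manifold R M m) (g : riemannian_metric S).
Variables (rho K alpha beta : R).
Hypotheses (rho_gt0 : 0 < rho) (K_gt0 : 0 < K).
Hypotheses (alpha_gt1 : 1 < alpha) (beta_gt1 : 1 < beta).
Variables (dOmega : measure_display) (Omega : measurableType dOmega).
Variables (P : probability Omega R) (phi : M -> {RV P >-> R}).
Hypothesis Hphi : forall x y : M, riemannian_dist g x y < rho ->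
  (P [set w | (r_fun beta (riemannian_dist g x y) < `|phi x w - phi y w|)%R]
     <= (q_fun K alpha m (riemannian_dist g x y))%:E)%E.

(** A small coordinate cube around [z] is rescaled to the unit cube. Its side is
    such that points at parameter distance $2^{-n}$ are at Riemannian distance less
    than [rho] and at most $2^{-n-1}$, so that the increment bounds at level $n$ are
    $(n+1)^{-\beta}$ and $K (n+1)^{-\alpha} 2^{-nm}$. *)
Lemma local_modification z : exists U psi,
  [/\ open U, U z & uniform_modification_on (riemannian_dist g) phi psi U].
Proof.
have [k [r [lambda [C [[ak kz r0 l0 C0] dist_k]]]]] := riemannian_dist_coord g z.
pose s := Num.min r (Num.min 1 rho / (2 * C)).
have s0 : 0 < s by rewrite lt_min r0 divr_gt0 ?mulr_gt0// lt_min ltr01.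
have sr : s <= r by rewrite ge_min lexx.
have Cs : C * s <= Num.min 1 rho / 2.
  rewrite mulrC -ler_pdivlMr// -mulrA -invfM.
  by rewrite ge_min lexx orbT.
have Cs1 : C * s <= 1 / 2.
  by apply: le_trans Cs _; rewrite ler_pM2r ?invr_gt0// ge_min lexx.
have Csrho : C * s < rho.
  apply: le_lt_trans Cs _; apply: (@le_lt_trans _ _ (rho / 2)); last first.
    by rewrite ltr_pdivrMr// ltr_pMr// ltr1n.
  by rewrite ler_pM2r ?invr_gt0// ge_min lexx orbT.
pose half : 'rV[R]_m := const_mx (1 / 2).
pose A (u : 'rV[R]_m) := chart_map k z + s *: (u - half).
pose B (x : 'rV[R]_m) := s^-1 *: (x - chart_map k z) + half.
have AB x : A (B x) = x.
  by rewrite /A /B addrK scalerA mulfV ?gt_eqF// scale1r addrC subrK.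
have B_dist x y : `|B x - B y| = s^-1 * `|x - y|.
  rewrite /B opprD addrACA subrr addr0 -scalerBr normrZ ger0_norm ?invr_ge0 ?ltW//.
  by rewrite opprB addrA subrK.
have A_dist u v : A u - A v = s *: (u - v).
  by rewrite /A opprD addrACA subrr add0r -scalerBr opprB addrA subrK.
have A_near u : unit_cube u -> `|A u - chart_map k z| <= r.
  move=> cu; rewrite /A addrC addKr normrZ gtr0_norm//.
  apply: le_trans sr; rewrite ler_piMr ?(ltW s0)//.
  apply/rV_norm_leP => // i; rewrite !mxE ler_norml.
  by have := cu i; lra.
pose a n : R := n.+1%:R `^ (- beta).
pose b n : R := K * n.+1%:R `^ (- alpha).
have ca : cvgn (series a) by exact: is_cvg_series_powR.
have cb : cvgn (series b).
  rewrite (_ : series b = fun n => K * series (fun i => i.+1%:R `^ (- alpha)) n).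
    by apply: is_cvgM; [exact: is_cvg_cst|exact: is_cvg_series_powR].
  by apply/funext => n; rewrite /series/= mulr_sumr.
pose X u : {RV P >-> R} := phi (chart_inv k (A u)).
have a0 n : 0 <= a n by exact: powR_ge0.
have b0 n : 0 <= b n by rewrite mulr_ge0 ?powR_ge0 ?ltW.
have X_incr n u v : unit_cube u -> unit_cube v -> `|u - v| <= 2 ^- n ->
    (P [set w | (a n < `|X u w - X v w|)%R] <= (b n / 2 ^+ (n * m))%:E)%E.
  move=> cu cv uv.
  have [_ /andP[d_ge d_le]] := dist_k _ _ (A_near u cu) (A_near v cv).
  set d := riemannian_dist g _ _ in d_ge d_le.
  have d0 : 0 <= d by apply: le_trans d_ge; rewrite mulr_ge0 ?(ltW l0).
  have {}d_le : d <= C * s * 2 ^- n.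
    apply: le_trans d_le _; rewrite A_dist normrZ (gtr0_norm s0) mulrA.
    by rewrite ler_pM2l ?mulr_gt0.
  have p0 : 0 < 2 ^- n :> R by rewrite invr_gt0 exprn_gt0.
  have p1 : 2 ^- n <= 1 :> R.
    by rewrite invf_le1 ?exprn_gt0// exprn_ege1// ler1n.
  have d_rho : d < rho.
    apply: le_lt_trans d_le _; apply: le_lt_trans Csrho.
    by rewrite ler_piMr// mulr_ge0 ?ltW.
  have d_n : d <= 2 ^- n.+1.
    apply: le_trans d_le _; rewrite exprS invfM ler_pM2r//.
    by rewrite -[2^-1]div1r.
  apply: le_trans (le_trans (Hphi d_rho) _).
    apply: le_measure; rewrite ?inE; [exact: measurable_RV_dist_gt..|].
    move=> w /=; apply: le_lt_trans; apply: r_fun_le => //.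
    by apply: ltW; apply: lt_trans beta_gt1.
  by rewrite lee_fin q_fun_le ?(ltW K_gt0)//; apply: ltW; apply: lt_trans alpha_gt1.
have [Y [Ymod Yunif]] := chaining_modification a0 b0 ca cb X_incr.
pose psi p : {RV P >-> R} := Y (B (chart_map k p)).
pose U := [set p | chart_dom k p /\ `|chart_map k p - chart_map k z| < s / 2].
have B_cube p : U p -> unit_cube (B (chart_map k p)).
  move=> [_ pz] i; rewrite !mxE.
  have := rV_coord_le (chart_map k p - chart_map k z) i.
  move=> /le_lt_trans/(_ pz); rewrite !mxE ltr_norml => /andP[h1 h2].
  have e1 : s^-1 * (s / 2) = 1 / 2 by field; exact: lt0r_neq0.
  have i0 : 0 < s^-1 by rewrite invr_gt0.
  have : s^-1 * - (s / 2) <= s^-1 * (chart_map k p 0 i - chart_map k z 0 i).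
    by rewrite ler_pM2l// ltW.
  have : s^-1 * (chart_map k p 0 i - chart_map k z 0 i) <= s^-1 * (s / 2).
    by rewrite ler_pM2l// ltW.
  by rewrite mulrN e1; lra.
have U_r p : U p -> `|chart_map k p - chart_map k z| <= r.
  by move=> [_ pz]; apply: le_trans sr; apply: ltW; apply: lt_le_trans pz _; lra.
have U_near p (e : R) : chart_dom k p -> 0 < e ->
    \forall q \near p, `|chart_map k p - chart_map k q| < e.
  move=> kp e0; have /cvgrPdist_lt := chart_map_continuous_at kp; exact.
have U_open : open U.
  rewrite openE => p [kp pz]; rewrite /interior.
  have e0 : 0 < s / 2 - `|chart_map k p - chart_map k z| by rewrite subr_gt0.
  apply: filterS2 (chart_dom_nbhs kp) (U_near p _ kp e0) => q kq pq; split => //.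
  rewrite -(subrK (chart_map k p) (chart_map k q)) -addrA.
  by apply: le_lt_trans (ler_normD _ _) _; rewrite distrC; move: pq; lra.
exists U, psi; split => //.
  by split => //; rewrite subrr normr0 divr_gt0.
split.
- move=> p Up; rewrite /psi.
  have := Ymod _ (B_cube p Up); rewrite /X AB chart_mapK//.
  by case: Up.
- move=> w p Up; apply/cvgrPdist_lt => e e0.
  have [delta d0 deltaP] := Yunif w e e0.
  have sd0 : 0 < s * delta by rewrite mulr_gt0.
  have Unbhs : nbhs p U by apply: open_nbhs_nbhs.
  apply: filterS2 Unbhs (U_near p _ Up.1 sd0) => q Uq pq.
  apply: deltaP; [exact: B_cube|exact: B_cube|].
  by rewrite B_dist mulrC ltr_pdivrMr// mulrC.
- move=> w e e0; have [delta d0 deltaP] := Yunif w e e0.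
  exists (lambda * (s * delta)); first by rewrite !mulr_gt0.
  move=> p q Up Uq pq.
  apply: deltaP; [exact: B_cube|exact: B_cube|].
  have [_ /andP[d_ge _]] := dist_k _ _ (U_r p Up) (U_r q Uq).
  rewrite !chart_mapK in d_ge; [|by case: Uq|by case: Up].
  rewrite B_dist mulrC ltr_pdivrMr// mulrC -(ltr_pM2l l0).
  exact: le_lt_trans d_ge pq.
Qed.

End local_modification.

(** * The modification *)

Theorem theorem3p1 (R : realType) (m : nat) (M : topologicalType)
    (S : smooth_manifold R M m) (Mconn : connected [set: M])
    (g : riemannian_metric S)
    (rho K alpha beta : R)
    (rho_gt0 : 0 < rho) (rho_le1 : rho <= 1) (K_gt0 : 0 < K)
    (alpha_gt1 : 1 < alpha) (beta_gt1 : 1 < beta)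
    (dOmega : measure_display) (Omega : measurableType dOmega)
    (P : probability Omega R) (phi : M -> {RV P >-> R})
    (Hphi : forall x y : M, riemannian_dist g x y < rho ->
      (P [set w | (r_fun beta (riemannian_dist g x y) < `|phi x w - phi y w|)%R]
         <= (q_fun K alpha m (riemannian_dist g x y))%:E)%E) :
  exists psi : M -> {RV P >-> R},
    modification phi psi /\
    forall w : Omega,
      locally_uniformly_continuous (riemannian_dist g) (fun x => psi x w).
Proof.
apply: glue_modifications; first exact: manifold_second_countable S.
by move=> z; apply: local_modification Hphi z.
Qed.
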